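(* There is a simple nuclear C*-algebra $B$ that has irreducible representations both on a separable Hilbert space and on a nonseparable Hilbert space.
   Context: A Hilbert space is separable if it has a countable dense subset, and nonseparable otherwise. C*-algebras are over $\mathbb{C}$ and are not assumed to be separable. *)

(* Defs.v *)
(* The complex numbers are [R[i]] for an arbitrary
   [R : realType].  Norms take their values in [R[i]], where [0 <= z] and
   [0 < z] include the assertion that [z] is real. *)
From mathcomp Require Import all_boot all_order all_algebra.
From mathcomp Require Import all_classical all_reals all_analysis.
From mathcomp Require Import complex.

Set Implicit Arguments.
Unset Strict Implicit.
Unset Printing Implicit Defensive.

Import Order.TTheory GRing.Theory Num.Theory.
Import numFieldNormedType.Exports.

Local Open Scope classical_set_scope.
Local Open Scope ring_scope.

(* Not necessarily unital, not necessarily separable. *)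
Record cstarAlgebra (R : realType) := CStarAlgebra {
  cstar_sort :> completeNormedModType R[i];
  cmul : cstar_sort -> cstar_sort -> cstar_sort;
  cstar : cstar_sort -> cstar_sort;
  cmulA : associative cmul;
  cmul_linearl : forall b, linear (cmul^~ b);
  cmul_linearr : forall a, linear (cmul a);
  cnormM : forall a b, `|cmul a b| <= `|a| * `|b|;
  cstarK : involutive cstar;
  cstar_antilinear :
    forall (c : R[i]) a b, cstar (c *: a + b) = c^* *: cstar a + cstar b;
  cstarM : forall a b, cstar (cmul a b) = cmul (cstar b) (cstar a);
  cstar_norm : forall a, `|cmul (cstar a) a| = `|a| ^+ 2
}.

(* The inner product is linear in the first variable. *)
Record hilbertSpace (R : realType) := HilbertSpace {
  hilbert_sort :> completeNormedModType R[i];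
  hdot : {dot hilbert_sort for Num.conj};
  hdot_norm : forall x, hdot x x = `|x| ^+ 2
}.

Definition separable (T : topologicalType) : Prop :=
  exists D : set T, countable D /\ dense D.

Definition closed_subspace (R : realType) (V : completeNormedModType R[i])
    (K : set V) : Prop :=
  [/\ closed K, K 0 & forall (c : R[i]) x y, K x -> K y -> K (c *: x + y)].

Definition closed_ideal (R : realType) (A : cstarAlgebra R) (I : set A) : Prop :=
  closed_subspace I /\
  forall a x : A, I x -> I (cmul a x) /\ I (cmul x a).

Definition simple_cstar (R : realType) (A : cstarAlgebra R) : Prop :=
  (exists a : A, a != 0) /\
  forall I : set A, closed_ideal I -> I = [set 0] \/ I = setT.

Record representation (R : realType) (A : cstarAlgebra R) (H : hilbertSpace R)
    (pi : A -> H -> H) : Prop := Representation {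
  rep_operator_linear : forall a, linear (pi a);
  rep_operator_bounded : forall a, continuous (pi a);
  rep_linear :
    forall (c : R[i]) a b x, pi (c *: a + b) x = c *: pi a x + pi b x;
  repM : forall a b x, pi (cmul a b) x = pi a (pi b x);
  rep_star : forall a x y, hdot H (pi a x) y = hdot H x (pi (cstar a) y)
}.

Definition irreducible_rep (R : realType) (A : cstarAlgebra R)
    (H : hilbertSpace R) (pi : A -> H -> H) : Prop :=
  [/\ representation pi,
      exists a x, pi a x != 0 &
      forall K : set H, closed_subspace K ->
        (forall a x, K x -> K (pi a x)) -> K = [set 0] \/ K = setT].

(* [X] is positive in the *-algebra of [k x k] matrices over a *-algebra [V]
   with operations [mul] and [star], that is, [X = Y^* Y] for some [Y]. *)
Definition mx_positive (V : nmodType) (mul : V -> V -> V) (star : V -> V)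
    (k : nat) (X : 'M[V]_k) : Prop :=
  exists Y : 'M[V]_k,
    forall i j, X i j = \sum_(l < k) mul (star (Y l i)) (Y l j).

Definition completely_positive (V W : nmodType)
    (mulV : V -> V -> V) (starV : V -> V)
    (mulW : W -> W -> W) (starW : W -> W) (f : V -> W) : Prop :=
  forall (k : nat) (X : 'M[V]_k),
    mx_positive mulV starV X -> mx_positive mulW starW (map_mx f X).

Definition adjmx (R : realType) (n : nat) (M : 'M[R[i]]_n) : 'M[R[i]]_n :=
  (M ^t Num.conj)%sesqui.

Definition l2norm (R : realType) (n : nat) (v : 'cV[R[i]]_n) : R[i] :=
  sqrtC (\sum_(i < n) `|v i 0| ^+ 2).

(* The operator norm of [M], acting on Euclidean [C^n], is at most [c]. *)
Definition opnorm_le (R : realType) (n : nat) (M : 'M[R[i]]_n) (c : R[i]) : Prop :=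
  0 <= c /\ forall v : 'cV[R[i]]_n, l2norm (M *m v) <= c * l2norm v.

(* The identity map of [A] is a point-norm limit of composites
   [A -> M_n(C) -> A] of contractive completely positive maps, as in
   Brown and Ozawa, "C*-algebras and Finite-Dimensional Approximations". *)
Definition nuclear (R : realType) (A : cstarAlgebra R) : Prop :=
  forall (F : seq A) (e : R[i]), 0 < e ->
  exists (n : nat) (phi : {linear A -> 'M[R[i]]_n})
         (psi : {linear 'M[R[i]]_n -> A}),
  [/\ completely_positive (@cmul R A) (@cstar R A)
        (@mulmx R[i] n n n) (@adjmx R n) phi,
      forall a, opnorm_le (phi a) `|a|,
      completely_positive (@mulmx R[i] n n n) (@adjmx R n)
        (@cmul R A) (@cstar R A) psi,
      forall M c, opnorm_le M c -> `|psi M| <= c &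
      forall a, a \in F -> `|psi (phi a) - a| < e].

(* Main.v *)
(* Let D and L be elementary abelian 2-groups with a nondegenerate pairing b
   into {0, 1}, where D is countable and L is not: D consists of the finite and
   L of the arbitrary sequences of bits.  On ell2 D let D act by translations and
   L by multiplication by characters; on ell2 L exchange the roles.  In both
   cases the unitaries satisfy u_d v_l = (-1)^b(d, l) v_l u_d.  B is the norm
   closure of the span of their products on ell2 D + ell2 L.

   Finitely many elements of D and L lie in finite subgroups in perfect duality,
   and those generate a full matrix algebra; so B is a closure of a directed
   union of full matrix algebras M_n.  Compression to the span of the n vectors
   indexed by the finite subgroup of D, followed by the embedding of M_n, gives
   nuclearity.  For simplicity, an ideal with a nonzero element contains some z
   with <z delta_0, delta_0> = t <> 0, and then sum_p e_p0 z e_0p, which is close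
   to t.1 when z is close to M_n.  Both summands of ell2 D + ell2 L are
   irreducible because the multiplications separate points and the translations
   are transitive. *)
From HB Require Import structures.
Require Import Defs.
From mathcomp Require Import all_boot all_order all_algebra.
From mathcomp Require Import finmap ssrAC.
From mathcomp Require Import all_classical all_reals all_analysis.
From mathcomp Require Import complex spectral.
From mathcomp Require Import ring lra.

Set Implicit Arguments.
Unset Strict Implicit.
Unset Printing Implicit Defensive.

Import Order.TTheory GRing.Theory Num.Theory.
Import numFieldNormedType.Exports.

Local Open Scope classical_set_scope.
Local Open Scope ring_scope.

Local Notation Re := complex.Re.
Local Notation Im := complex.Im.

(** * Completeness of the complex numbers *)

(** An irreducible representation of a separable C*-algebra acts on a separable space, so an
    uncountable group has to enter. The size of each summand is that of the group that translates
    it; the other group only has to separate points. A countable group can thus be paired with an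
    uncountable one, and exchanging the roles changes the size of the space. Both actions share one
    operator norm, so restriction to either summand is contractive at no cost and the two norms need
    no prior comparison. In return, estimates must also hold on [ell2 L], where the finite subgroup
    of [D] indexes no vectors; they are drawn from identities between matrix units. Perfect duality
    of finite subgroups is reached one element at a time, as in a symplectic Gram-Schmidt process:
    correct the new element to be orthogonal to what is there, then adjoin it with a partner.
    Exponent 2 makes all characters real signs and every group element its own inverse. *)

Section SequentialCompleteness.
Variable R : realType.
Local Notation C := R[i].

(** The order of [R[i]] is partial, but [0 <= x] already makes [x] real, so the supremum can be
    taken in [R] through real parts. Operator norms and unconditional sums get their existence from
    here. *)
Lemma nonneg_lubC (A : set C) M :
  A !=set0 -> (forall x, A x -> 0 <= x) -> (forall x, A x -> x <= M) ->
  exists s, (forall x, A x -> x <= s) /\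
    (forall K, (forall x, A x -> x <= K) -> s <= K).
Proof.
move=> [a Aa] A0 AM.
have R0 x : A x -> x = (Re x)%:C%C.
  by move=> /A0 /ger0_real /RRe_real ->.
pose E : set R := [set Re x | x in A].
have supE : has_sup E.
  split; first by exists (Re a), a.
  exists (Re M) => _ [x Ax <-].
  by move: (AM _ Ax); rewrite lecE => /andP[].
exists (sup E)%:C%C; split=> [x Ax|K AK].
  rewrite (R0 _ Ax) lecR; apply: ub_le_sup; first by case: supE.
  by exists x.
have KK : (Re K)%:C%C = K.
  by apply/RRe_real/ger0_real/(le_trans (A0 _ Aa))/AK.
rewrite -KK lecR; apply: ge_sup; first by case: supE.
by move=> _ [x Ax <-]; move: (AK _ Ax); rewrite lecE => /andP[].
Qed.

(** A fixed null sequence; limits below are stated as inequalities with this rate, valid for every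
    index. *)
Definition hseq (n : nat) : C := n.+1%:R^-1.

Lemma hseq_gt0 n : 0 < hseq n. Proof. by rewrite invr_gt0 ltr0n. Qed.

Lemma hseq_ge0 n : 0 <= hseq n. Proof. exact/ltW/hseq_gt0. Qed.

Lemma hseq_small (e : C) : 0 < e -> exists n, forall m, (n <= m)%N -> hseq m < e.
Proof.
move=> e0; have eE : e = (Re e)%:C%C by rewrite RRe_real// gtr0_real.
have e0' : 0 < Re e by move: e0; rewrite {1}eE ltcR.
have [n ne] : exists n : nat, (Re e)^-1 < n%:R.
  by exists (Num.bound (Re e)^-1); rewrite archi_boundP// invr_ge0 ltW.
exists n => m nm; rewrite /hseq -[ltRHS]invrK ltf_pV2 ?posrE ?ltr0n ?invr_gt0//.
rewrite eE -fmorphV -(rmorph_nat (real_complex R)) ltcR (lt_le_trans ne)//.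
by rewrite ler_nat (leq_trans nm).
Qed.

Lemma le0_hseq (x K : C) : 0 <= K -> (forall n, x <= K * hseq n) -> x <= 0.
Proof.
(* Being comparable with a real number makes [x] real, which is needed before [x <= 0] can be
   negated into [0 < x]. *)
move=> K0 xK; have xr : x \is Num.real.
  have := xK 0%N; rewrite -subr_ge0 => /ger0_real.
  by move=> h; rewrite -[x](subKr (K * hseq 0)) rpredB// realM// ger0_real// hseq_ge0.
rewrite real_leNgt ?real0//; apply/negP => x0.
have K1 : 0 < K + 1 by rewrite ltr_wpDl.
have [n /(_ _ (leqnn _)) hn] := hseq_small (divr_gt0 x0 K1).
have := xK n; rewrite real_leNgt// ?realM ?ger0_real ?hseq_ge0// => /negP; apply.
rewrite ltr_pdivlMr // mulrC in hn; apply: le_lt_trans hn.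
by rewrite ler_pM2r ?hseq_gt0// lerDl.
Qed.

Lemma ler_hseq (x y K : C) : 0 <= K -> (forall n, x <= y + K * hseq n) -> x <= y.
Proof.
by move=> K0 h; rewrite -subr_le0; apply: (le0_hseq K0) => n; rewrite lerBlDl.
Qed.

Lemma ler_addgt0C (x y : C) : (forall e, 0 < e -> x <= y + e) -> x <= y.
Proof. by move=> h; apply: (@ler_hseq _ _ 1) => // n; rewrite mul1r h// hseq_gt0. Qed.

Lemma eq0_hseq (V : normedZmodType C) (x : V) (K : C) :
  0 <= K -> (forall n, `|x| <= K * hseq n) -> x = 0.
Proof.
move=> K0 h; apply/eqP; rewrite -normr_eq0 eq_le normr_ge0 andbT.
exact: le0_hseq h.
Qed.

Definition fast_cauchy (V : normedZmodType C) (K : C) (u : nat -> V) :=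
  forall n m, `|u n - u m| <= K * (hseq n + hseq m).

(** The constant 4 is slack that lets one rate serve every space below; combining real and imaginary
    parts, for instance, costs only 2. *)
Definition fast_complete (V : normedZmodType C) :=
  forall (K : C) (u : nat -> V), fast_cauchy K u ->
  exists l, forall n, `|u n - l| <= 4%:R * K * hseq n.

Lemma fast_cauchy_ge0 (V : normedZmodType C) K (u : nat -> V) :
  fast_cauchy K u -> 0 <= K.
Proof.
move=> /(_ 0%N 0%N); rewrite subrr normr0 pmulr_lge0//.
by rewrite addr_gt0 ?hseq_gt0.
Qed.

Let rhseq (n : nat) : R := n.+1%:R^-1.

Let hseqE n : hseq n = (rhseq n)%:C%C.
Proof. by rewrite /hseq /rhseq fmorphV rmorph_nat. Qed.

(** The intervals of radius [K * rhseq n] around [u n] meet pairwise, so the supremum of their left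
    endpoints lies in all of them. *)
Let fast_complete_real (K : R) (u : nat -> R) :
  (forall n m, `|u n - u m| <= K * (rhseq n + rhseq m)) ->
  exists l, forall n, `|u n - l| <= K * rhseq n.
Proof.
move=> cu; pose E := range (fun n => u n - K * rhseq n).
have bE m : ubound E (u m + K * rhseq m).
  move=> _ [n _ <-]; have := cu n m; rewrite ler_norml => /andP[_].
  by rewrite mulrDr; lra.
have supE : has_sup E.
  by split; [exists (u 0 - K * rhseq 0), 0%N | exists (u 0 + K * rhseq 0)].
exists (sup E) => n; rewrite ler_norml; apply/andP; split.
  have : sup E <= u n + K * rhseq n by apply: ge_sup; [case: supE | exact: bE].
  lra.
have : u n - K * rhseq n <= sup E.
  by apply: ub_le_sup; [case: supE | exists n].
lra.
Qed.

Lemma fast_completeC : fast_complete C.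
Proof.
move=> K u cu; have K0 := fast_cauchy_ge0 cu.
have KE : K = (Re K)%:C%C by rewrite RRe_real// ger0_real.
have K0' : 0 <= Re K by move: K0; rewrite {1}KE lecR.
have cuR (n m : nat) : Re `|u n - u m| <= Re K * (rhseq n + rhseq m).
  by have := cu n m; rewrite KE !hseqE -rmorphD -rmorphM lecE => /andP[_].
have leRe (z : C) : `|Re z| <= Re `|z| /\ `|Im z| <= Re `|z|.
  rewrite normc_def /=; split.
    by rewrite -sqrtr_sqr ler_sqrt ?lerDl ?addr_ge0 ?sqr_ge0.
  by rewrite -sqrtr_sqr ler_sqrt ?lerDr ?addr_ge0 ?sqr_ge0.
have ReB (x y : C) : Re (x - y) = Re x - Re y by case: x y => [? ?] [].
have ImB (x y : C) : Im (x - y) = Im x - Im y by case: x y => [? ?] [].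
have [a ha] : exists l, forall n, `|Re (u n) - l| <= Re K * rhseq n.
  apply: fast_complete_real => n m; apply: le_trans (cuR n m).
  by rewrite -ReB; case: (leRe (u n - u m)).
have [b hb] : exists l, forall n, `|Im (u n) - l| <= Re K * rhseq n.
  apply: fast_complete_real => n m; apply: le_trans (cuR n m).
  by rewrite -ImB; case: (leRe (u n - u m)).
exists (a +i* b)%C => n.
have -> : u n - (a +i* b)%C = (Re (u n) - a)%:C%C + 'i%C * (Im (u n) - b)%:C%C.
  by rewrite [LHS]complexE ReB ImB.
apply: (le_trans (ler_normD _ _)); rewrite normrM complexiE normCi mul1r.
rewrite normc_def/= expr0n addr0 sqrtr_sqr.
rewrite normc_def/= expr0n addr0 sqrtr_sqr -rmorphD hseqE.
rewrite [K]KE -(rmorph_nat (real_complex R)) -!rmorphM lecR.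
have := ha n; have := hb n; have : 0 <= Re K * rhseq n by rewrite mulr_ge0// invr_ge0.
lra.
Qed.

(** With [fast_complete_cvg], the passage between filters and sequences with a rate: this direction
    serves a given Hilbert space, the other one the two spaces constructed below. *)
Lemma complete_fast (V : completeNormedModType C) : fast_complete V.
Proof.
move=> K u cu; have K0 := fast_cauchy_ge0 cu.
have /cvg_ex[l /cvgrPdist_lt ul] : cvg (u @ \oo).
  apply: cauchy_cvg; apply: cauchy_exP => e e0.
  have K1 : 0 < 2 * K + 1 by rewrite ltr_wpDl// mulr_ge0.
  have [n hn] := hseq_small (divr_gt0 e0 K1).
  exists (u n); exists n => // m /= nm; rewrite -ball_normE /=.
  apply: (le_lt_trans (cu n m)).
  have := hn n (leqnn _); rewrite ltr_pdivlMr// mulrC; apply: le_lt_trans.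
  apply: (@le_trans _ _ (K * (hseq n + hseq n))).
    apply: ler_wpM2l => //; rewrite lerD2l lef_pV2 ?posrE ?ltr0n// ler_nat.
    by rewrite ltnS.
  rewrite -subr_ge0.
  have -> : (2 * K + 1) * hseq n - K * (hseq n + hseq n) = hseq n by ring.
  exact: hseq_ge0.
exists l => n.
have : `|u n - l| <= K * hseq n.
  apply: ler_addgt0C => e e0.
  have e2 : 0 < e / 2 by rewrite divr_gt0.
  have K1 : 0 < K + 1 by rewrite ltr_wpDl.
  have [N1 h1] := hseq_small (divr_gt0 e2 K1).
  have [N2 _ h2] := ul _ e2.
  pose m := maxn N1 N2.
  have -> : u n - l = (u n - u m) + (u m - l) by rewrite addrA subrK.
  apply: (le_trans (ler_normD _ _)).
  have := h2 m (leq_maxr _ _); rewrite distrC => /ltW um.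
  have hm := h1 m (leq_maxl _ _); rewrite ltr_pdivlMr// mulrC in hm.
  apply: (le_trans (lerD (cu n m) um)).
  rewrite mulrDr -addrA lerD2l [leRHS]splitr lerD2r.
  by apply: (le_trans _ (ltW hm)); rewrite ler_pM2r ?hseq_gt0// lerDl.
move=> h; apply: (le_trans h); rewrite ler_pM2r ?hseq_gt0//.
by rewrite ler_peMl// ler1n.
Qed.

Lemma fast_complete_cvg (V : normedModType C) : fast_complete V ->
  forall F : set_system V, ProperFilter F -> cauchy F -> cvg F.
Proof.
move=> cV F FF cF.
(* Two of these balls belong to the filter together, hence meet, so their centres form a fast Cauchy
   sequence with constant 1. *)
have /choice[u Fu] : forall n, exists x, F (ball x (hseq n)).
  by move=> n; have /cauchyP/(_ _ (hseq_gt0 n))[x Fx] := cF; exists x.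
have [] := cV 1 u.
  move=> n m; have /filter_ex[x] : F (ball (u n) (hseq n) `&` ball (u m) (hseq m)).
    exact: filterI.
  rewrite -ball_normE /= => -[h1 h2]; rewrite mul1r.
  have -> : u n - u m = (u n - x) + (x - u m) by rewrite addrA subrK.
  apply: (le_trans (ler_normD _ _)); apply: lerD; first exact: ltW.
  by rewrite distrC ltW.
move=> l hl; apply/cvg_ex; exists l; apply/cvgrPdist_lt => e e0.
(* The 5 is the rate 4 of the limit plus 1 for the radius of the ball. *)
have e6 : 0 < e / 5 by rewrite divr_gt0.
have [n /(_ _ (leqnn _)) hn] := hseq_small e6.
apply: filterS (Fu n) => x; rewrite -ball_normE /= => hx.
have -> : l - x = - (u n - l) + (u n - x) by rewrite opprB addrA subrK.
apply: (le_lt_trans (ler_normD _ _)); rewrite normrN.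
apply: (@le_lt_trans _ _ (4 * 1 * hseq n + hseq n)).
  by apply: lerD => //; exact: ltW.
rewrite ltr_pdivlMr// in hn.
by have -> : 4 * 1 * hseq n + hseq n = hseq n * 5 by ring.
Qed.

End SequentialCompleteness.

(** * The Hilbert space of square summable families *)

Section UnconditionalSums.
Variables (R : realType) (I : choiceType).
Local Notation C := R[i].
Implicit Types (f g : I -> C) (A B : {fset I}).
Local Open Scope fset_scope.
Local Open Scope ring_scope.

(** Convergence along the directed set of finite subsets: the index type may be uncountable, so no
    enumeration is available. *)
Definition has_sum f (s : C) := forall e, 0 < e ->
  exists A, forall B, A `<=` B -> `|\sum_(i <- B) f i - s| <= e.

Lemma has_sum_unique f s t : has_sum f s -> has_sum f t -> s = t.
Proof.
move=> hs ht; apply/eqP; rewrite -subr_eq0 -normr_le0; apply: ler_addgt0C => e e0.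
rewrite add0r; have e2 : 0 < e / 2 by rewrite divr_gt0.
have [A hA] := hs _ e2; have [B hB] := ht _ e2.
have {}hA := hA (A `|` B) (fsubsetUl _ _).
have {}hB := hB (A `|` B) (fsubsetUr _ _).
rewrite [leRHS]splitr -(subrKA (\sum_(i <- A `|` B) f i)).
by apply: (le_trans (ler_normD _ _)); rewrite lerD// distrC.
Qed.

Lemma has_sumD f g s t : has_sum f s -> has_sum g t ->
  has_sum (fun i => f i + g i) (s + t).
Proof.
move=> hs ht e e0; have e2 : 0 < e / 2 by rewrite divr_gt0.
have [A hA] := hs _ e2; have [B hB] := ht _ e2.
exists (A `|` B) => X; rewrite fsubUset => /andP[/hA {}hA /hB {}hB].
rewrite big_split /= opprD addrACA [leRHS]splitr.
by apply: (le_trans (ler_normD _ _)); rewrite lerD.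
Qed.

Lemma has_sumZ f s c : has_sum f s -> has_sum (fun i => c * f i) (c * s).
Proof.
move=> hs e e0; have c0 : 0 < `|c| + 1 by rewrite ltr_wpDl.
have [A hA] := hs _ (divr_gt0 e0 c0).
exists A => X /hA {}hA; rewrite -mulr_sumr -mulrBr normrM.
rewrite ler_pdivlMr// mulrC in hA; apply: le_trans hA.
by rewrite ler_wpM2r// lerDl.
Qed.

Lemma has_sum_conj f s : has_sum f s -> has_sum (fun i => (f i)^*) s^*.
Proof.
move=> hs e e0; have [A hA] := hs _ e0.
by exists A => X /hA; rewrite -rmorph_sum -rmorphB norm_conjC.
Qed.

Lemma has_sum_ge0 f s A : (forall i, 0 <= f i) -> has_sum f s ->
  \sum_(i <- A) f i <= s.
Proof.
move=> f0 hs; have f0s B : 0 <= \sum_(i <- B) f i by rewrite sumr_ge0.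
(* A sum of real terms equals its own conjugate, by uniqueness of sums. *)
have sr : s \is Num.real.
  rewrite CrealE; apply/eqP/esym/(has_sum_unique hs).
  have -> : f = fun i => (f i)^* by apply/funext => i; rewrite conj_Creal// ger0_real.
  exact: has_sum_conj.
apply: ler_addgt0C => e e0; have [B hB] := hs _ e0.
have := hB (A `|` B) (fsubsetUr _ _) => {}hB.
apply: (@le_trans _ _ (\sum_(i <- A `|` B) f i)).
  rewrite (big_fsetID _ (mem A) (A `|` B))/=.
  have -> : [fset x in A `|` B | x \in A] = A.
    by apply/fsetP => x; rewrite !inE /= andb_idl// => ->.
  by rewrite lerDl sumr_ge0.
by move: hB; rewrite real_ler_distl ?rpredB// ?(ger0_real (f0s _))// => /andP[_].
Qed.

Lemma has_sum_le f s K : (forall i, 0 <= f i) -> has_sum f s ->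
  (forall A, \sum_(i <- A) f i <= K) -> s <= K.
Proof.
move=> f0 hs hK; apply: ler_addgt0C => e e0; have [A hA] := hs _ e0.
have {}hA := hA _ (fsubset_refl _).
have f0s : 0 <= \sum_(i <- A) f i by rewrite sumr_ge0.
have sA := has_sum_ge0 A f0 hs.
have s0 : 0 <= s by apply: le_trans sA.
move: hA; rewrite distrC ger0_norm ?subr_ge0// lerBlDl => h.
by apply: (le_trans h); rewrite lerD2r.
Qed.

Lemma has_sum_finsupp f A : (forall i, i \notin A -> f i = 0) ->
  has_sum f (\sum_(i <- A) f i).
Proof.
move=> fA e e0; exists A => B AB; rewrite (big_fsetID _ (mem A) B)/=.
have -> : [fset x in B | x \in A] = A.
  by apply/fsetP => x; rewrite !inE /= andb_idl// => /(fsubsetP AB).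
rewrite addrC addrK big_seq_cond big1 ?normr0 ?ltW// => i.
by rewrite andbT !inE /= => /andP[_ /fA].
Qed.

(** Choose finite sets [A n] whose absolute sums come within [hseq n] of the supremum. Whatever is
    added to [A n] then changes the sum of [f] by at most [hseq n], so the sums over the [A n]
    converge and their limit is the unconditional sum. *)
Lemma has_sum_exists f K : (forall A, \sum_(i <- A) `|f i| <= K) ->
  exists s, has_sum f s.
Proof.
move=> hK; pose E := [set \sum_(i <- A) `|f i| | A in [set: {fset I}]].
have [|_ [A _ <-]|_ [A _ <-]//|S [ubS lubS]] := @nonneg_lubC R E K.
- by exists (\sum_(i <- fset0) `|f i|); exists fset0.
- exact: sumr_ge0.
have /choice[A hA] : forall n, exists A : {fset I}, S - hseq R n <= \sum_(i <- A) `|f i|.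
  move=> n; apply: contrapT => /forallNP h.
  have : S <= S - hseq R n.
    apply: lubS => _ [A _ <-].
    have S0 : S \is Num.real.
      apply: ger0_real; apply: le_trans (ubS (\sum_(i <- A) `|f i|) _); last by exists A.
      exact: sumr_ge0.
    have /negP := h A; rewrite -real_ltNge; first exact: ltW.
      by rewrite ger0_real// sumr_ge0.
    by rewrite rpredB// ger0_real// hseq_ge0.
  by rewrite lerDl oppr_ge0 lt_geF ?hseq_gt0.
have near n (B : {fset I}) : A n `<=` B ->
    `|\sum_(i <- B) f i - \sum_(i <- A n) f i| <= hseq R n.
  move=> AB; have BA : [fset x in B | x \in A n] = A n.
    by apply/fsetP => x; rewrite !inE /= andb_idl// => /(fsubsetP AB).
  rewrite (big_fsetID _ (mem (A n)) B)/= BA addrC addrK.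
  apply: (le_trans (ler_norm_sum _ _ _)).
  have : \sum_(i <- B) `|f i| <= S by apply: ubS; exists B.
  rewrite (big_fsetID _ (mem (A n)) B)/= BA -lerBrDl => h.
  by apply: (le_trans h); rewrite lerBlDl -lerBlDr.
have [] := @fast_completeC R 1 (fun n => \sum_(i <- A n) f i).
  move=> n m; rewrite mul1r -(subrKA (\sum_(i <- A n `|` A m) f i)).
  apply: (le_trans (ler_normD _ _)); apply: lerD.
    by rewrite distrC near// fsubsetUl.
  by rewrite near// fsubsetUr.
move=> s hs; exists s => e e0.
have [n /(_ _ (leqnn _)) hn] := hseq_small (divr_gt0 e0 (ltr0n _ 5)).
exists (A n) => B AB; rewrite -(subrKA (\sum_(i <- A n) f i)).
apply: (le_trans (ler_normD _ _)); apply: (le_trans (lerD (near _ _ AB) (hs n))).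
rewrite ltr_pdivlMr// in hn; apply: le_trans (ltW hn).
by have -> : hseq R n + 4 * 1 * hseq R n = hseq R n * 5 by ring.
Qed.

End UnconditionalSums.

(** * The norm of a dot product *)

Section CauchySchwarz.
Variables (C : numClosedFieldType) (U : lmodType C) (form : {dot U for Num.conj}).

Lemma dotC u v : form u v = (form v u)^*.
Proof. by rewrite [LHS]hermC expr0 mul1r. Qed.

Lemma dot_cauchy_schwarz u v :
  `|form u v| <= sqrtC (form u u) * sqrtC (form v v).
Proof.
have [->|v0] := eqVneq v 0.
  by rewrite !linear0r normr0 sqrtC0 mulr0.
rewrite -(@ler_pXn2r _ 2) ?nnegrE ?mulr_ge0 ?sqrtC_ge0 ?dnorm_ge0//.
rewrite exprMn !sqrtCK.
have vv : 0 < form v v by rewrite dnorm_gt0.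
(* The component of [u] orthogonal to [v], multiplied by [form v v] to avoid division; the spare
   factor [form v v] is cancelled at the end. *)
have := dnorm_ge0 form (form v v *: u - form u v *: v); rewrite dnormB !dnormZ.
have -> : form (form v v *: u) (form u v *: v) =
    form v v * ((form u v)^* * form u v) by rewrite linearZl_LR linearZr_LR.
rewrite (ger0_norm (ltW vv)) normCK.
have -> : (form v v * ((form u v)^* * form u v))^* = form v v * ((form u v)^* * form u v).
  rewrite geC0_conj// mulr_ge0 ?(ltW vv)// -normCKC.
  by rewrite exprn_ge0.
set a := form v v in vv *; set b := form u v; set c := form u u.
have -> : a ^+ 2 * c + b * b^* * a - (a * (b^* * b) + a * (b^* * b)) =
  a * (c * a - b * b^*) by ring.
by rewrite pmulr_rge0// subr_ge0.
Qed.

Definition dot_norm (u : U) : C := sqrtC (form u u).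

Lemma dot_normD u v : dot_norm (u + v) <= dot_norm u + dot_norm v.
Proof.
rewrite -(@ler_pXn2r _ 2) ?nnegrE ?addr_ge0 ?sqrtC_ge0 ?dnorm_ge0//.
rewrite sqrtCK dnormD sqrrD !sqrtCK -!addrA lerD2l addrC [leRHS]addrA lerD2r -[leRHS]mulr2n.
have -> : form u v + (form u v)^* = 'Re (form u v) *+ 2.
  by rewrite ReE -mulr_natr divfK// pnatr_eq0.
rewrite lerMn2r /=; apply: le_trans (dot_cauchy_schwarz u v).
by case: (leif_Re_Creal (form u v)).
Qed.

Lemma dot_normZ c u : dot_norm (c *: u) = `|c| * dot_norm u.
Proof. by rewrite /dot_norm dnormZ sqrtCM ?nnegrE ?exprn_ge0 ?dnorm_ge0// sqrCK. Qed.

Lemma dot_norm_eq0 u : dot_norm u = 0 -> u = 0.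
Proof. by move=> /eqP; rewrite sqrt_dnorm_eq0 => /eqP. Qed.

End CauchySchwarz.

(** * Square summable families over an arbitrary index type *)

Section Ell2.
Variables (R : realType) (I : choiceType).
Local Notation C := R[i].
Implicit Types A B : {fset I}.

Definition square_summable : {pred (I -> C^o)} :=
  fun f => `[< exists K, forall A, \sum_(i <- A) `|f i| ^+ 2 <= K >].

Lemma square_summable_submod : submod_closed square_summable.
Proof.
split.
  apply/asboolP; exists 0 => A; rewrite big1// => i _.
  by rewrite normr0 expr0n.
move=> c f g /asboolP[K hK] /asboolP[M hM]; apply/asboolP.
(* From [(x + y) ^+ 2 <= 2 * x ^+ 2 + 2 * y ^+ 2]. *)
exists (2 * `|c| ^+ 2 * K + 2 * M) => A.
apply: (@le_trans _ _ (\sum_(i <- A) (2 * `|c| ^+ 2 * `|f i| ^+ 2 + 2 * `|g i| ^+ 2))).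
  apply: ler_sum => i _; rewrite -mulrA -exprMn -normrM.
  rewrite fctE /=.
  have h : `|c * f i + g i| <= `|c * f i| + `|g i| by exact: ler_normD.
  have : `|c * f i + g i| ^+ 2 <= (`|c * f i| + `|g i|) ^+ 2.
    by rewrite ler_pXn2r ?nnegrE// addr_ge0.
  move=> /le_trans; apply; rewrite -subr_ge0.
  set x := `|c * f i|; set y := `|g i|.
  have -> : 2 * x ^+ 2 + 2 * y ^+ 2 - (x + y) ^+ 2 = (x - y) ^+ 2 by ring.
  by rewrite -realEsqr rpredB// normr_real.
by rewrite big_split -!mulr_sumr lerD// ler_wpM2l// mulr_ge0// exprn_ge0.
Qed.

HB.instance Definition _ := GRing.isSubmodClosed.Build C (I -> C^o)
  square_summable square_summable_submod.

Record ell2 := Ell2 { ell2_fun :> I -> C^o; ell2P : ell2_fun \in square_summable }.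

HB.instance Definition _ := [isSub for ell2_fun].
HB.instance Definition _ := [Choice of ell2 by <:].
HB.instance Definition _ := [SubChoice_isSubLmodule of ell2 by <:].

Implicit Types f g : ell2.

Lemma ell2_eq f g : f =1 g -> f = g.
Proof. by move=> fg; apply/val_inj/funext. Qed.

Lemma ell2D f g i : (f + g) i = f i + g i. Proof. by []. Qed.
Lemma ell2N f i : (- f) i = - f i. Proof. by []. Qed.
Lemma ell2Z c f i : (c *: f) i = c * f i. Proof. by []. Qed.
Lemma ell20 i : (0 : ell2) i = 0. Proof. by []. Qed.

Lemma ell2_sum (J : Type) (s : seq J) (F : J -> ell2) i :
  (\sum_(j <- s) F j) i = \sum_(j <- s) F j i.
Proof. by apply: (big_morph (fun f : ell2 => f i)) => //. Qed.

(** The default 0 is never taken: [ell2_dotP] bounds the absolute sums through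
    [x * y <= x ^+ 2 + y ^+ 2], so the sum always exists. *)
Definition ell2_dot f g : C := xget 0 (has_sum (fun i => f i * (g i)^*)).

Lemma ell2_dotP f g : has_sum (fun i => f i * (g i)^*) (ell2_dot f g).
Proof.
rewrite /ell2_dot; case: xgetP => // h; exfalso.
have /asboolP[K hK] := ell2P f; have /asboolP[M hM] := ell2P g.
suff [s hs] : exists s, has_sum (fun i => f i * (g i)^*) s by exact: (h s).
apply: (@has_sum_exists _ _ _ (K + M)) => A.
apply: (@le_trans _ _ (\sum_(i <- A) (`|f i| ^+ 2 + `|g i| ^+ 2))); last first.
  by rewrite big_split lerD.
apply: ler_sum => i _; rewrite normrM norm_conjC -subr_ge0.
set x := `|f i|; set y := `|g i|.
have -> : x ^+ 2 + y ^+ 2 - x * y = ((x - y) ^+ 2 + x ^+ 2 + y ^+ 2) / 2 by field.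
by rewrite divr_ge0// !addr_ge0// -realEsqr ?rpredB// normr_real.
Qed.

Lemma ell2_dotE f g s : has_sum (fun i => f i * (g i)^*) s -> ell2_dot f g = s.
Proof. exact: has_sum_unique (ell2_dotP f g). Qed.

Lemma ell2_dot_herm f g : ell2_dot f g = (-1) ^+ false * (ell2_dot g f)^*.
Proof.
rewrite expr0 mul1r; apply: ell2_dotE.
have -> : (fun i => f i * (g i)^*) = (fun i => (g i * (f i)^*)^*).
  by apply/funext => i; rewrite rmorphM /= conjCK mulrC.
exact/has_sum_conj/ell2_dotP.
Qed.

Lemma ell2_dotDl g : {morph ell2_dot^~ g : f f' / f + f'}.
Proof.
move=> f f'; apply: ell2_dotE.
have -> : (fun i => (f + f') i * (g i)^*) = (fun i => f i * (g i)^* + f' i * (g i)^*).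
  by apply/funext => i; rewrite mulrDl.
exact/has_sumD/ell2_dotP/ell2_dotP.
Qed.

Lemma ell2_dotZl c f g : ell2_dot (c *: f) g = c * ell2_dot f g.
Proof.
apply: ell2_dotE.
have -> : (fun i => (c *: f) i * (g i)^*) = (fun i => c * (f i * (g i)^*)).
  by apply/funext => i; rewrite mulrA.
exact/has_sumZ/ell2_dotP.
Qed.

Lemma ell2_dot_bilinear : bilinear_for *%R (Num.conj \; *%R) ell2_dot.
Proof.
split=> [g c f f'|f c g g'].
  by rewrite ell2_dotDl ell2_dotZl.
rewrite ell2_dot_herm [in RHS]ell2_dot_herm [X in _ = _ + X]ell2_dot_herm.
by rewrite !expr0 !mul1r ell2_dotDl ell2_dotZl rmorphD rmorphM.
Qed.

HB.instance Definition _ := bilinear_isBilinear.Build C ell2 ell2 C _ _ ell2_dot ell2_dot_bilinear.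
HB.instance Definition _ := isHermitianSesquilinear.Build C ell2 false Num.conj ell2_dot
  ell2_dot_herm.

Lemma ell2_dot_gt0 f : f != 0 -> 0 < ell2_dot f f.
Proof.
move=> f0; have [i fi] : exists i, f i != 0.
  apply: contrapT => /forallNP h; move/eqP: f0; apply.
  by apply: ell2_eq => i; apply/eqP; apply: contrapT => /negP; exact: h.
have := @has_sum_ge0 _ _ _ _ [fset i]%fset _ (ell2_dotP f f).
rewrite big_seq_fset1 => h; apply: (lt_le_trans _ (h _)).
  by rewrite -normCK exprn_gt0 ?normr_gt0.
by move=> j; rewrite -normCK exprn_ge0.
Qed.

HB.instance Definition _ := isDotProduct.Build C ell2 ell2_dot ell2_dot_gt0.

HB.instance Definition _ := Lmodule_isNormed.Build C ell2
  (@dot_normD C ell2 ell2_dot) (@dot_normZ C ell2 ell2_dot) (@dot_norm_eq0 C ell2 ell2_dot).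
End Ell2.

Section Ell2Hilbert.
Variables (R : realType) (I : choiceType).
Local Notation C := R[i].
Local Notation H := (ell2 R I).
Implicit Types (A B : {fset I}) (f g : H).

Lemma ell2_normE f : `|f| ^+ 2 = ell2_dot f f.
Proof. exact: sqrtCK. Qed.

Lemma ell2_norm_sum f : has_sum (fun i => `|f i| ^+ 2) (`|f| ^+ 2).
Proof.
rewrite ell2_normE; have -> : (fun i => `|f i| ^+ 2) = (fun i => f i * (f i)^*).
  by apply/funext => i; rewrite normCK.
exact: ell2_dotP.
Qed.

Lemma ell2_partial_norm f A : \sum_(i <- A) `|f i| ^+ 2 <= `|f| ^+ 2.
Proof. by apply: has_sum_ge0 (ell2_norm_sum f) => i; rewrite exprn_ge0. Qed.

Lemma ell2_coord_le f i : `|f i| <= `|f|.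
Proof.
rewrite -(@ler_pXn2r _ 2) ?nnegrE//.
by have := ell2_partial_norm f [fset i]%fset; rewrite big_seq_fset1.
Qed.

Lemma ell2_norm_le f (K : C) : 0 <= K ->
  (forall A, \sum_(i <- A) `|f i| ^+ 2 <= K ^+ 2) -> `|f| <= K.
Proof.
move=> K0 h; rewrite -(@ler_pXn2r _ 2) ?nnegrE//.
by apply: has_sum_le (ell2_norm_sum f) h => i; rewrite exprn_ge0.
Qed.

(** The limit is taken coordinatewise. Over a fixed finite set the distance estimate passes to the
    limit with an error of order [hseq m], which [ler_hseq] removes; the resulting bound is uniform
    in the finite set. *)
Lemma ell2_fast_complete : fast_complete H.
Proof.
move=> K u cu; have K0 := fast_cauchy_ge0 cu.
have cc i : fast_cauchy K (fun n => u n i : C).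
  by move=> n m; apply: le_trans (cu n m); exact: ell2_coord_le (u n - u m) i.
have /choice[l hl] : forall i, exists l : C, forall n, `|(u n i : C) - l| <= 4 * K * hseq R n.
  by move=> i; exact: fast_completeC (cc i).
have key n A : \sum_(i <- A) `|(u n i : C) - l i| ^+ 2 <= (4 * K * hseq R n) ^+ 2.
  pose a := hseq R n; have a0 : 0 <= a := hseq_ge0 R n.
  pose c : C := (size A)%:R; have c0 : 0 <= c by rewrite ler0n.
  (* This coefficient is read off from the final difference: with it, all terms containing [b]
     combine into multiples of [b * (1 - b)]. It may depend on the size of [A], since [A] is fixed
     while [m] grows. *)
  apply: (@ler_hseq _ _ _ (2 * K ^+ 2 * (1 + 2 * a) + 32 * K ^+ 2 * c)).
    by rewrite addr_ge0// !mulr_ge0// ?exprn_ge0// addr_ge0// mulr_ge0.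
  move=> m; pose b := hseq R m; have b0 : 0 <= b := hseq_ge0 R m.
  have b1 : b <= 1 by rewrite /b invf_le1 ?ltr0n// ler1n.
  apply: (@le_trans _ _ (\sum_(i <- A) (2 * `|(u n - u m) i : C| ^+ 2 + 2 * (4 * K * b) ^+ 2))).
    apply: ler_sum => i _; have h := hl i m.
    have -> : (u n i : C) - l i = (u n - u m) i + ((u m i : C) - l i).
      by rewrite ell2D ell2N addrA subrK.
    have h1 := ler_normD ((u n - u m) i : C) ((u m i : C) - l i).
    have h2 : `|((u n - u m) i : C) + ((u m i : C) - l i)| ^+ 2 <=
              (`|(u n - u m) i : C| + 4 * K * b) ^+ 2.
      rewrite ler_pXn2r ?nnegrE ?addr_ge0 ?mulr_ge0//.
      by apply: (le_trans h1); rewrite lerD2l.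
    apply: (le_trans h2); rewrite -subr_ge0.
    set x := `|_|; set y := 4 * K * b.
    have -> : 2 * x ^+ 2 + 2 * y ^+ 2 - (x + y) ^+ 2 = (x - y) ^+ 2 by ring.
    by rewrite -realEsqr rpredB// ?normr_real// ger0_real// !mulr_ge0.
  rewrite big_split /= -mulr_sumr big_const_seq count_predT.
  have -> : iter (size A) (+%R (2 * (4 * K * b) ^+ 2)) 0 = c * (2 * (4 * K * b) ^+ 2).
    by rewrite iter_addr_0 -[LHS]mulr_natl.
  apply: (@le_trans _ _ (2 * (K * (a + b)) ^+ 2 + c * (2 * (4 * K * b) ^+ 2))).
    rewrite lerD2r ler_wpM2l//; have hp := ell2_partial_norm (u n - u m) A.
    apply: (le_trans hp); rewrite ler_pXn2r ?nnegrE//.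
    by rewrite mulr_ge0// addr_ge0.
  rewrite -subr_ge0 -/a -/b.
  have -> : (4 * K * a) ^+ 2 + (2 * K ^+ 2 * (1 + 2 * a) + 32 * K ^+ 2 * c) * b -
    (2 * (K * (a + b)) ^+ 2 + c * (2 * (4 * K * b) ^+ 2)) =
    14 * K ^+ 2 * a ^+ 2 + 2 * K ^+ 2 * (b * (1 - b)) + 32 * K ^+ 2 * c * (b * (1 - b)) by ring.
  have K2 : 0 <= K ^+ 2 by rewrite exprn_ge0.
  have a2 : 0 <= a ^+ 2 by rewrite exprn_ge0.
  have b1' : 0 <= 1 - b by rewrite subr_ge0.
  by rewrite !addr_ge0 // !mulr_ge0.
(* The limit differs from [u 0] by a family that [key] bounds. *)
have lP : (l : I -> C^o) \in @square_summable R I.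
  have -> : (l : I -> C^o) = (u 0%N : I -> C^o) - ((u 0%N : I -> C^o) - l).
    by apply/funext => i; rewrite !fctE subKr.
  rewrite rpredB ?ell2P//; apply/asboolP.
  by exists ((4 * K * hseq R 0) ^+ 2) => A; exact: key.
exists (Ell2 lP) => n; apply: ell2_norm_le => [|A]; last exact: key.
by rewrite !mulr_ge0// hseq_ge0.
Qed.

HB.instance Definition _ := Uniform_isComplete.Build H
  (fast_complete_cvg ell2_fast_complete).

Definition ell2_hilbert : hilbertSpace R :=
  @HilbertSpace R H (@ell2_dot R I : {dot H for Num.conj}) (fun f => esym (ell2_normE f)).

End Ell2Hilbert.

Section Ell2Delta.
Variables (R : realType) (I : choiceType).
Local Notation C := R[i].
Local Notation H := (ell2 R I).
Implicit Types (A B : {fset I}) (f g : H).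

Lemma finsupp_square_summable (h : I -> C^o) A :
  (forall i, i \notin A -> h i = 0) -> h \in @square_summable R I.
Proof.
move=> hA; apply/asboolP; exists (\sum_(i <- A) `|h i| ^+ 2) => B.
apply: has_sum_ge0 => [i|]; first by rewrite exprn_ge0.
by apply: has_sum_finsupp => i /hA ->; rewrite normr0 expr0n.
Qed.

Definition delta_fun (i : I) : I -> C^o := fun j => (j == i)%:R.

Lemma delta_summable i : delta_fun i \in @square_summable R I.
Proof.
apply: (@finsupp_square_summable _ [fset i]%fset) => j.
by rewrite inE /delta_fun => /negbTE ->.
Qed.

Definition delta i : H := Ell2 (delta_summable i).

Lemma deltaE i j : delta i j = (j == i)%:R. Proof. by []. Qed.

Lemma ell2_dot_delta f i : ell2_dot f (delta i) = f i.
Proof.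
apply: ell2_dotE; have := @has_sum_finsupp R _ (fun j => f j * (delta i j)^*) [fset i]%fset.
rewrite big_seq_fset1 deltaE eqxx conjC1 mulr1; apply => j.
by rewrite inE deltaE => /negbTE ->; rewrite conjC0 mulr0.
Qed.

Lemma norm_delta i : `|delta i| = 1.
Proof.
apply/eqP; rewrite -(@eqrXn2 _ 2)// expr1n ell2_normE ell2_dot_delta.
by rewrite deltaE eqxx.
Qed.

(** The squares of [f] outside a suitable [A] sum to at most [e ^+ 2], and [g] lives there,
    dominated by [f]. The set depends on [f] alone, so it can be fixed before [g] is constructed. *)
Lemma ell2_tail f (e : C) : 0 < e -> exists A, forall g,
  (forall i, i \in A -> g i = 0) -> (forall i, `|g i : C| <= `|f i : C|) -> `|g| <= e.
Proof.
move=> e0; have [A hA] := ell2_norm_sum f (exprn_gt0 2 e0).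
exists A => g gA gf; apply: ell2_norm_le => [|B]; first exact: ltW.
have {}hA := hA _ (fsubset_refl _).
have BA : [fset i in B `|` A | i \in A]%fset = A.
  by apply/fsetP => x; rewrite !inE /= andb_idl// => ->; rewrite orbT.
have := ell2_partial_norm f (B `|` A)%fset.
rewrite (big_fsetID _ (mem A))/= BA -lerBrDl => h.
apply: (@le_trans _ _ (\sum_(i <- [fset i in B `|` A | i \notin A]%fset) `|f i| ^+ 2)).
  have -> : \sum_(i <- B) `|g i| ^+ 2 =
      \sum_(i <- [fset i in B `|` A | i \notin A]%fset) `|g i| ^+ 2.
    rewrite (big_fsetID _ (mem A) B)/= big_seq_cond big1 ?add0r; last first.
      by move=> i; rewrite andbT !inE => /andP[_ /gA ->]; rewrite normr0 expr0n.
    suff -> : [fset i in B `|` A | i \notin A]%fset = [fset i in B | i \notin A]%fset by [].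
    by apply/fsetP => x; rewrite !inE /=; case: (x \in A); rewrite ?andbF// orbF.
  by apply: ler_sum => i _; rewrite ler_pXn2r ?nnegrE//.
apply: (le_trans h); move: hA; rewrite distrC ger0_norm//.
by rewrite subr_ge0 ell2_partial_norm.
Qed.

End Ell2Delta.

(** * Signed pullbacks along partial bijections *)

Section Pull.
Variables (R : realType).
Local Notation C := R[i].

Definition sg (b : bool) : C := (-1) ^+ b.

Lemma sgD b b' : sg (b (+) b') = sg b * sg b'.
Proof. by rewrite /sg signr_addb. Qed.

Lemma sg_conj b : (sg b)^* = sg b.
Proof. by rewrite /sg rmorph_sign. Qed.

Lemma norm_sg b : `|sg b| = 1.
Proof. exact: normr_sign. Qed.

Lemma sgK b : sg b * sg b = 1.
Proof. by rewrite -sgD addbb. Qed.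

Variables (I J : choiceType).

Definition partial_inverse (k : I -> option J) (k' : J -> option I) :=
  forall i j, (k i == Some j) = (k' j == Some i).

(** Both sides are the sum of [F] over the pairs of [A] and [B] on the graph of [k], taken in the
    two possible orders. *)
Lemma sum_partial_inverse k k' (F : I -> J -> C) (A : {fset I}) (B : {fset J}) :
  partial_inverse k k' ->
  (forall i j, i \in A -> k i = Some j -> j \in B) ->
  (forall i j, j \in B -> k' j = Some i -> i \in A) ->
  \sum_(i <- A) (if k i is Some j then F i j else 0) =
  \sum_(j <- B) (if k' j is Some i then F i j else 0).
Proof.
move=> kk' AB BA.
transitivity (\sum_(i <- A) \sum_(j <- B) (if k i == Some j then F i j else 0)).
  apply: eq_big_seq => i iA; case E : (k i) => [j|]; last by rewrite big1.
  have jB := AB _ _ iA E; rewrite (big_fsetD1 _ jB)/= eqxx.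
  rewrite big_seq_cond big1 ?addr0// => j'; rewrite andbT !inE => /andP[/negbTE jj' _].
  by rewrite -[Some j == _]/(j == j') eq_sym jj'.
rewrite exchange_big /=; apply: eq_big_seq => j jB.
case E : (k' j) => [i|]; last by rewrite big1// => i _; rewrite kk' E.
have iA := BA _ _ jB E; rewrite (big_fsetD1 _ iA)/= kk' E eqxx.
rewrite big_seq_cond big1 ?addr0// => i'; rewrite andbT !inE => /andP[/negbTE ii' _].
by rewrite kk' E -[Some i == _]/(i == i') eq_sym ii'.
Qed.

Definition pimage (k : I -> option J) (A : {fset I}) : {fset J} :=
  [fset j in pmap k A]%fset.

Lemma pimageP k A j : reflect (exists2 i, i \in A & k i = Some j) (j \in pimage k A).
Proof.
rewrite /pimage inE /= mem_pmap.
by apply: (iffP mapP) => -[i iA E]; exists i.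
Qed.

Variables (k : I -> option J) (k' : J -> option I).
Hypothesis kk' : partial_inverse k k'.

Lemma partial_inverseP i j : k i = Some j <-> k' j = Some i.
Proof. by split => /eqP; [rewrite kk' => /eqP | rewrite -kk' => /eqP]. Qed.

(** One construction for translations, multiplications by characters, extension by zero and
    restriction of coordinates: norm bound and adjoint are then proved once. *)
Definition pull_fun (s : I -> bool) (f : J -> C^o) : I -> C^o :=
  fun i => if k i is Some j then sg (s i) * f j else 0.

Lemma pull_partial_sum s (f : ell2 R J) (A : {fset I}) :
  \sum_(i <- A) `|pull_fun s f i| ^+ 2 <= `|f| ^+ 2.
Proof.
pose B := pimage k A.
apply: (@le_trans _ _ (\sum_(j <- B) `|f j| ^+ 2)); last exact: ell2_partial_norm.
pose F (i : I) j := if i \in A then `|f j| ^+ 2 else 0.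
have -> : \sum_(i <- A) `|pull_fun s f i| ^+ 2 =
    \sum_(i <- A) (if k i is Some j then F i j else 0).
  apply: eq_big_seq => i iA; rewrite /pull_fun /F iA.
  by case: (k i) => [j|]; rewrite ?normr0 ?expr0n// normrM norm_sg mul1r.
rewrite (@sum_partial_inverse k k' F A B kk').
- apply: ler_sum => j _; case: (k' j) => [i|]; rewrite /F; last by rewrite exprn_ge0.
  by case: ifP => // _; rewrite exprn_ge0.
- by move=> i j iA kij; apply/pimageP; exists i.
- move=> i j /pimageP[i' iA /partial_inverseP E] E'.
  by move: iA; rewrite E' in E; case: E => ->.
Qed.

Lemma pull_summable s (f : ell2 R J) : pull_fun s f \in @square_summable R I.
Proof. by apply/asboolP; exists (`|f| ^+ 2) => A; exact: pull_partial_sum. Qed.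

Definition pull s f : ell2 R I := Ell2 (pull_summable s f).

Lemma pullE s f i : pull s f i = if k i is Some j then sg (s i) * f j else 0.
Proof. by []. Qed.

Lemma pull_linear s : linear (pull s).
Proof.
move=> c f g; apply: ell2_eq => i; rewrite ell2D ell2Z !pullE.
by case: (k i) => [j|]; rewrite ?mulr0 ?addr0// ell2D ell2Z mulrDr mulrCA.
Qed.

Lemma pull_norm_le s f : `|pull s f| <= `|f|.
Proof. by apply: ell2_norm_le => // A; exact: pull_partial_sum. Qed.

End Pull.

Section PullAdjoint.
Variables (R : realType) (I J : choiceType).
Variables (k : I -> option J) (k' : J -> option I).
Hypothesis kk' : partial_inverse k k'.

Lemma partial_inverse_sym : partial_inverse k' k.
Proof. by move=> j i; rewrite kk'. Qed.

Lemma pull_adjoint s s' (f : ell2 R J) (g : ell2 R I) :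
  (forall i j, k i = Some j -> s i = s' j) ->
  ell2_dot (pull kk' s f) g = ell2_dot f (pull partial_inverse_sym s' g).
Proof.
move=> ss'; pose F (i : I) (j : J) : R[i] := sg R (s i) * f j * (g i)^*.
apply/esym/ell2_dotE => e e0.
have [A hA] := ell2_dotP (pull kk' s f) g e0.
exists (pimage k A) => B AB.
(* Since [B] contains the image of [A], this enlargement makes [A'] and [B] correspond under [k] in
   both directions, so the two finite sums are equal and not merely close. *)
pose A' := (A `|` pimage k' B)%fset.
have := hA A' (fsubsetUl _ _).
have -> : \sum_(i <- A') pull kk' s f i * (g i)^* =
    \sum_(i <- A') (if k i is Some j then F i j else 0).
  by apply: eq_bigr => i _; rewrite pullE /F; case: (k i) => [j|]//; rewrite mul0r.
rewrite (@sum_partial_inverse _ _ _ _ k' F A' B kk').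
- have -> // : \sum_(j <- B) (if k' j is Some i then F i j else 0) =
    \sum_(j <- B) f j * (pull partial_inverse_sym s' g j)^*.
  apply: eq_bigr => j _; rewrite pullE /F; case E : (k' j) => [i|]; last first.
    by rewrite conjC0 mulr0.
  rewrite rmorphM /= sg_conj (ss' i j); last exact/(partial_inverseP kk').
  by rewrite mulrA [sg _ _ * _]mulrC.
- move=> i j; rewrite in_fsetU => /orP[iA|/pimageP[j' jB E]] kij.
    by apply: (fsubsetP AB); apply/pimageP; exists i.
  by move/(partial_inverseP kk'): E; rewrite kij => -[->].
- by move=> i j jB E; rewrite in_fsetU; apply/orP; right; apply/pimageP; exists j.
Qed.

End PullAdjoint.

(** * Truncation and invariant subspaces *)

Section Ell2Approximation.
Variables (R : realType) (I : choiceType).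
Local Notation C := R[i].
Local Notation H := (ell2 R I).
Implicit Types (A B : {fset I}) (f g : H).

Lemma closed_approx (V : normedModType C) (K : set V) z : closed K ->
  (forall e, 0 < e -> exists2 x, K x & `|z - x| <= e) -> K z.
Proof.
move=> cK h; apply: cK => U /nbhs_ballP[e /= e0 eU].
have e2 : 0 < e / 2 by rewrite divr_gt0.
have [x Kx zx] := h _ e2; exists x; split => //; apply: eU.
rewrite -ball_normE /=; apply: (le_lt_trans zx).
by rewrite ltr_pdivrMr// ltr_pMr// ltr1n.
Qed.

Lemma ell2_truncE f A i : (\sum_(j <- A) f j *: delta R j) i = if i \in A then f i else 0.
Proof.
rewrite ell2_sum; under eq_bigr do rewrite ell2Z deltaE.
case: ifPn => iA.
  rewrite (big_fsetD1 _ iA)/= eqxx mulr1 big_seq_cond big1 ?addr0// => j.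
  by rewrite andbT !inE eq_sym => /andP[/negbTE -> _]; rewrite mulr0.
rewrite big_seq_cond big1// => j; rewrite andbT => jA.
by case: eqP => [ij|]; rewrite ?mulr0//; move: iA; rewrite ij jA.
Qed.

Lemma ell2_approx f (e : C) : 0 < e ->
  exists A, `|f - \sum_(j <- A) f j *: delta R j| <= e.
Proof.
move=> e0; have [A hA] := ell2_tail f e0; exists A; apply: hA => i.
  by move=> iA; rewrite ell2D ell2N ell2_truncE iA subrr.
rewrite ell2D ell2N ell2_truncE; case: ifP => _; first by rewrite subrr normr0.
by rewrite subr0.
Qed.

Lemma partial_inverse_id : partial_inverse (@Some I) (@Some I).
Proof. by move=> i j; rewrite -[LHS]/(i == j) eq_sym. Qed.

Definition mulsg (s : I -> bool) : H -> H := pull partial_inverse_id s.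

Lemma mulsgE s f i : mulsg s f i = sg R (s i) * f i. Proof. by []. Qed.

(* Averaging [f] with its images under sign multiplications kills prescribed
   coordinates, so a nonzero invariant closed subspace contains some [delta x]. *)
Lemma ell2_invariant_subspace (K : set H) : closed_subspace K ->
  (forall x y : I, x != y -> exists2 s, s x != s y & forall f, K f -> K (mulsg s f)) ->
  (forall x y : I, K (delta R x) -> K (delta R y)) ->
  K = [set 0] \/ K = setT.
Proof.
move=> [cK K0 Klin] Ksep Ktrans.
have KD f g : K f -> K g -> K (f + g).
  by move=> Kf Kg; rewrite -[f]scale1r; exact: Klin.
have KZ c f : K f -> K (c *: f).
  by move=> Kf; rewrite -[c *: f]addr0; exact: Klin.
have [[f Kf f0]|K00] := pselect (exists2 f, K f & f != 0); last first.
  left; apply/seteqP; split=> [f Kf|f ->//]; apply/eqP; apply: contrapT => /negP f0.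
  by apply: K00; exists f.
right; have [x fx] : exists i, f i != 0.
  apply: contrapT => /forallNP h; move/eqP: f0; apply.
  by apply: ell2_eq => i; apply/eqP; apply: contrapT => /negP; exact: h.
(* Domination by [f] is carried through the induction so that the tail estimate chosen for [f]
   applies to every [g] obtained. *)
have cut (s : seq I) : exists g, [/\ K g, g x = f x,
    forall i, i \in s -> i != x -> g i = 0 & forall i, `|g i : C| <= `|f i : C|].
  elim: s => [|y s [g [Kg gx gs gf]]]; first by exists f.
  have [yx|yx] := eqVneq y x.
    exists g; split=> // i; rewrite inE => /orP[/eqP -> |]; last exact: gs.
    by rewrite yx eqxx.
  have [t txy Kt] := Ksep _ _ yx.
  (* The total sign in the second term is 1 at [x] and, because [t] separates [x] from [y], it is -1
     at [y]. *)
  exists (2^-1 *: (g + sg R (t x) *: mulsg t g)); split.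
  - exact/KZ/KD/KZ/Kt.
  - rewrite ell2Z ell2D ell2Z mulsgE mulrA sgK mul1r gx.
    by rewrite -[f x + f x]mulr2n -[f x *+ 2]mulr_natl mulKf.
  - move=> i; rewrite ell2Z ell2D ell2Z mulsgE mulrA -sgD.
    have [-> _ _|iy] := eqVneq i y.
      have -> : t x (+) t y = true by case: (t x) (t y) txy => [] [].
      by rewrite /sg expr1 mulN1r subrr mulr0.
    by rewrite inE (negbTE iy) /= => /gs h /h ->; rewrite mulr0 addr0 mulr0.
  - move=> i; apply: le_trans (gf i).
    rewrite ell2Z ell2D ell2Z mulsgE mulrA -sgD normrM normfV.
    rewrite (ger0_norm (ler0n _ 2)) mulrC ler_pdivrMr//.
    apply: (le_trans (ler_normD _ _)); rewrite normrM norm_sg mul1r.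
    by rewrite mulr_natr.
have Kx : K (delta R x).
  apply: closed_approx => // e e0.
  have nfx : 0 < `|f x : C| by rewrite normr_gt0.
  (* The factor [f x] compensates for the later division by it: the vector cut on [A] differs from
     [f x *: delta R x] only outside [A]. *)
  have [A hA] := ell2_tail f (mulr_gt0 e0 nfx).
  have [g [Kg gx gA gf]] := cut A.
  exists ((f x)^-1 *: g); first exact: KZ.
  have -> : delta R x - (f x)^-1 *: g = - ((f x)^-1 *: (g - f x *: delta R x)).
    by rewrite scalerBr scalerA mulVf// scale1r opprB.
  rewrite normrN normrZ normfV mulrC ler_pdivrMr//; apply: hA => i.
    rewrite ell2D ell2N ell2Z deltaE; have [-> _|ix /gA/(_ ix) ->] := eqVneq i x.
      by rewrite gx mulr1 subrr.
    by rewrite mulr0 subrr.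
  rewrite ell2D ell2N ell2Z deltaE; have [->|ix] := eqVneq i x.
    by rewrite gx mulr1 subrr normr0.
  by rewrite mulr0 subr0.
apply/seteqP; split=> // g _; apply: closed_approx => // e e0.
have [A hA] := ell2_approx g e0; exists (\sum_(j <- A) g j *: delta R j) => //.
apply: (big_ind K) => // j _; exact/KZ/(Ktrans x).
Qed.

End Ell2Approximation.

(** * Separability depends on the index type *)

Section Separability.
Variable R : realType.
Local Notation C := R[i].

Lemma complex_rat_dense (z e : C) : 0 < e ->
  exists q : rat * rat, `|z - (ratr q.1 +i* ratr q.2)%C| <= e.
Proof.
move=> e0; have eE : e = (Re e)%:C%C by rewrite RRe_real// gtr0_real.
have r0 : 0 < Re e / 2 by move: e0; rewrite {1}eE ltcR => ?; rewrite divr_gt0.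
have app (x : R) : exists q : rat, `|x - ratr q| <= Re e / 2.
  have [q] := @rat_in_itvoo R (x - Re e / 2) (x + Re e / 2) ltac:(lra).
  by rewrite in_itv /= => /andP[h1 h2]; exists q; rewrite ler_distl; apply/andP; split; lra.
have [a ha] := app (Re z); have [b hb] := app (Im z); exists (a, b) => /=.
have -> : z - (ratr a +i* ratr b)%C = (Re z - ratr a)%:C%C + 'i%C * (Im z - ratr b)%:C%C.
  by rewrite [LHS]complexE; case: z {ha hb} => [? ?].
apply: (le_trans (ler_normD _ _)); rewrite normrM complexiE normCi mul1r.
rewrite normc_def/= expr0n addr0 sqrtr_sqr.
rewrite normc_def/= expr0n addr0 sqrtr_sqr -rmorphD eE lecR; lra.
Qed.

Lemma ell2_separable (I : countType) : separable (ell2 R I).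
Proof.
pose F (s : seq (I * (rat * rat))) : ell2 R I :=
  \sum_(t <- s) (ratr t.2.1 +i* ratr t.2.2)%C *: delta R t.1.
exists (range F); split; first exact: sub_countable (card_image_le _ _) (countableP _).
move=> O [f Of] oO.
have /nbhs_ballP[e /= e0 eO] : nbhs f O by exact: open_nbhs_nbhs.
have e3 : 0 < e / 3 by rewrite divr_gt0.
have [A hA] := ell2_approx f e3.
have c0 : 0 < (#|` A|.+1)%:R :> C by rewrite ltr0n.
(* The error [e / 3] is shared among the coefficients; the successor keeps the denominator nonzero
   when [A] is empty. *)
have /choice[q hq] : forall i, exists q : rat * rat,
    `|(f i : C) - (ratr q.1 +i* ratr q.2)%C| <= e / 3 / (#|` A|.+1)%:R.
  by move=> i; apply: complex_rat_dense; rewrite divr_gt0.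
pose s := [seq (i, q i) | i <- A].
exists (F s); split; last by exists s.
apply: eO; rewrite -ball_normE /=.
have -> : f - F s = (f - \sum_(j <- A) f j *: delta R j) +
   \sum_(j <- A) ((f j : C) - (ratr (q j).1 +i* ratr (q j).2)%C) *: delta R j.
  rewrite /F /s big_map /= -addrA; congr (_ + _).
  under [X in _ + X]eq_bigr do rewrite scalerBl.
  by rewrite sumrB addKr.
apply: (le_lt_trans (ler_normD _ _)).
apply: (@le_lt_trans _ _ (e / 3 + e / 3)); last first.
  by rewrite -subr_gt0; have -> : e - (e / 3 + e / 3) = e / 3 by field.
apply: lerD => //; apply: (le_trans (ler_norm_sum _ _ _)).
apply: (@le_trans _ _ (\sum_(j <- A) (e / 3 / (#|` A|.+1)%:R))).
  by apply: ler_sum => j _; rewrite normrZ norm_delta mulr1.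
rewrite big_const_seq count_predT iter_addr_0 -[leLHS]mulr_natr.
rewrite -mulrA ger_pMr// mulrC ler_pdivrMr// mul1r ler_nat.
exact: leqnSn.
Qed.

(** Distinct basis vectors already differ by 1 in one coordinate, so points of a dense set within
    1/2 of them are distinct, and a countable dense set would make the index type countable. *)
Lemma ell2_nonseparable (I : choiceType) : ~ countable [set: I] -> ~ separable (ell2 R I).
Proof.
move=> nI [D [cD dD]]; apply: nI.
have /choice[d hd] : forall i : I, exists x, D x /\ `|delta R i - x| < 2^-1.
  move=> i; have [] := dD (ball (delta R i) (2^-1 : C)).
  - by exists (delta R i); apply: ballxx; rewrite invr_gt0.
  - exact: ball_open.
  - by move=> x [bx Dx]; exists x; split => //; move: bx; rewrite -ball_normE.
have d_inj : injective d.
  move=> i j ij; apply: contrapT => /eqP nij.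
  have : `|(delta R i - delta R j) i : C| < 1.
    apply: (le_lt_trans (ell2_coord_le _ _)).
    rewrite -(subrKA (d i)); apply: (le_lt_trans (ler_normD _ _)).
    rewrite [X in _ + X]distrC [ltRHS]splitr mul1r; apply: ltrD.
      by case: (hd i).
    by rewrite ij; case: (hd j).
  by rewrite ell2D ell2N !deltaE eqxx (negbTE nij) subr0 normr1 ltxx.
move/countable_injP: cD => [h h_inj]; apply/countable_injP; exists (h \o d) => i j _ _ hij.
by apply: d_inj; apply: h_inj => //; rewrite inE; [case: (hd i) | case: (hd j)].
Qed.

End Separability.

(** * Norm-closed operator algebras *)

Section HilbertTheory.
Variables (R : realType) (H : hilbertSpace R).
Local Notation C := R[i].
Implicit Types x y : H.

Lemma hdot_sqrt x : sqrtC (hdot H x x) = `|x|.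
Proof. by rewrite hdot_norm sqrCK. Qed.

Lemma hdot_le x y : `|hdot H x y| <= `|x| * `|y|.
Proof. by rewrite -!hdot_sqrt; exact: dot_cauchy_schwarz. Qed.

Lemma hdotC x y : hdot H x y = (hdot H y x)^*.
Proof. exact: dotC. Qed.

Lemma hdotDl x y z : hdot H (x + y) z = hdot H x z + hdot H y z.
Proof. exact: linearDl. Qed.

Lemma hdotBl x y z : hdot H (x - y) z = hdot H x z - hdot H y z.
Proof. exact: linearBl. Qed.

Lemma hdotZl c x z : hdot H (c *: x) z = c * hdot H x z.
Proof. exact: linearZl_LR. Qed.

Lemma hdotDr x y z : hdot H z (x + y) = hdot H z x + hdot H z y.
Proof. exact: linearDr. Qed.

Lemma hdotBr x y z : hdot H z (x - y) = hdot H z x - hdot H z y.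
Proof. exact: linearBr. Qed.

Lemma hdotZr c x z : hdot H z (c *: x) = c^* * hdot H z x.
Proof. exact: linearZr_LR. Qed.

Lemma hdot_extl x y : (forall z, hdot H x z = hdot H y z) -> x = y.
Proof.
move=> h; apply/eqP; rewrite -subr_eq0 -normr_eq0 -sqrf_eq0 -hdot_norm.
by rewrite hdotBl h subrr.
Qed.

Lemma hdot_extr x y : (forall z, hdot H z x = hdot H z y) -> x = y.
Proof. by move=> h; apply: hdot_extl => z; rewrite hdotC h -hdotC. Qed.

Definition op_bound (f : H -> H) (K : C) := 0 <= K /\ forall x, `|f x| <= K * `|x|.

Definition op_adjoint (f g : H -> H) := forall x y, hdot H (f x) y = hdot H x (g y).

Lemma op_adjoint_sym f g : op_adjoint f g -> op_adjoint g f.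
Proof. by move=> fg x y; rewrite hdotC -fg -hdotC. Qed.

Lemma op_adjoint_unique f g g' : op_adjoint f g -> op_adjoint f g' -> g = g'.
Proof.
by move=> fg fg'; apply/funext => y; apply: hdot_extr => x; rewrite -fg fg'.
Qed.

(** Testing the adjoint relation on [g x] itself gives [|g x|^2 <= K |g x| |x|], and one factor
    cancels. *)
Lemma op_adjoint_bound f g K : op_adjoint f g -> op_bound f K -> op_bound g K.
Proof.
move=> fg [K0 fK]; split=> // x.
have [->|gx] := eqVneq (g x) 0; first by rewrite normr0 mulr_ge0.
have ngx : 0 < `|g x| by rewrite normr_gt0.
rewrite -(ler_pM2r ngx) -expr2 -hdot_norm -fg.
have := hdot_le (f (g x)) x; rewrite fg hdot_norm (ger0_norm (exprn_ge0 _ _))// => h.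
apply: (le_trans h); rewrite mulrAC.
by rewrite ler_wpM2r// fK.
Qed.

Lemma op_adjoint_sub f g f' g' : op_adjoint f g -> op_adjoint f' g' ->
  op_adjoint (fun x => f x - f' x) (fun x => g x - g' x).
Proof. by move=> fg fg' x y; rewrite hdotBl hdotBr fg fg'. Qed.

Lemma op_bound_ext f K x : op_bound f K -> `|f x| <= K * `|x|.
Proof. by case. Qed.

Definition op_norm (f : H -> H) : C :=
  xget 0 [set s | op_bound f s /\ forall K, op_bound f K -> s <= K].

Lemma op_normP f K : op_bound f K ->
  op_bound f (op_norm f) /\ forall M, op_bound f M -> op_norm f <= M.
Proof.
move=> fK; rewrite /op_norm; case: xgetP => [s _ []//|none]; exfalso.
(* The extra element 0 keeps [E] nonempty on the zero space and makes the supremum nonnegative. *)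
pose E := [set r | r = 0 \/ exists2 x : H, x != 0 & r = `|f x| / `|x|].
have EM M : op_bound f M -> forall r, E r -> r <= M.
  move=> [M0 fM] r [->//|[x x0 ->]].
  by rewrite ler_pdivrMr ?normr_gt0.
have [|||s [ubs lubs]] := @nonneg_lubC R E K.
- by exists 0; left.
- by move=> r [->//|[x _ ->]]; rewrite divr_ge0.
- exact: EM.
apply: (none s); split; last first.
  by move=> M fM; apply: lubs; exact: EM.
split=> [|x]; first by apply: ubs; left.
have [->|x0] := eqVneq x 0.
  by have := op_bound_ext 0 fK; rewrite !normr0 !mulr0.
by rewrite -ler_pdivrMr ?normr_gt0//; apply: ubs; right; exists x.
Qed.

End HilbertTheory.

(** The adjoint is only asserted to exist within the set; [op_adjoint_unique] determines it, so no
    star operation is part of the data. *)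
Record operatorAlgebra (R : realType) (H : hilbertSpace R) := OperatorAlgebra {
  oper :> (H -> H) -> Prop;
  oper0 : oper 0;
  operL : forall (c : R[i]) f g, oper f -> oper g -> oper (c *: f + g);
  operM : forall f g, oper f -> oper g -> oper (f \o g);
  oper_linear : forall f, oper f -> linear f;
  oper_bounded : forall f, oper f -> exists K, op_bound f K;
  oper_adjoint : forall f, oper f -> exists2 g, oper g & op_adjoint f g
}.

Section NormClosure.
Variables (R : realType) (H : hilbertSpace R) (S : operatorAlgebra H).
Local Notation C := R[i].

(** A condition on arbitrary functions: linearity, boundedness and existence of an adjoint are all
    inherited from the approximants. *)
Definition norm_closure : {pred (H -> H)} := fun f =>
  `[< forall e : C, 0 < e -> exists2 b, S b & op_bound (fun x => f x - b x) e >].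

Lemma norm_closureP f :
  reflect (forall e : C, 0 < e -> exists2 b, S b & op_bound (fun x => f x - b x) e)
    (f \in norm_closure).
Proof. exact: asboolP. Qed.

Lemma oper_norm_closure f : S f -> f \in norm_closure.
Proof.
move=> Sf; apply/norm_closureP => e e0; exists f => //; split=> [|x]; first exact: ltW.
by rewrite subrr normr0 mulr_ge0// ltW.
Qed.

Lemma norm_closure_submod : submod_closed norm_closure.
Proof.
split; first exact/oper_norm_closure/oper0.
move=> c f g /norm_closureP hf /norm_closureP hg; apply/norm_closureP => e e0.
have c0 : 0 < `|c| + 1 by rewrite ltr_wpDl.
have e2 : 0 < e / 2 by rewrite divr_gt0.
have [b Sb [_ fb]] := hf _ (divr_gt0 e2 c0); have [b' Sb' [_ gb']] := hg _ e2.
exists (c *: b + b'); first exact: operL.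
split=> [|x]; first exact: ltW.
have -> : (c *: f + g) x - (c *: b + b') x = c *: (f x - b x) + (g x - b' x).
  by rewrite !fctE scalerBr opprD addrACA.
apply: (le_trans (ler_normD _ _)); rewrite [e in leRHS]splitr mulrDl lerD//.
rewrite normrZ; apply: (@le_trans _ _ ((`|c| + 1) * `|f x - b x|)).
  by rewrite ler_wpM2r// lerDl.
rewrite mulrC -ler_pdivlMr//; apply: (le_trans (fb x)).
by rewrite mulrAC.
Qed.

HB.instance Definition _ := GRing.isSubmodClosed.Build C (H -> H)
  norm_closure norm_closure_submod.

Record closed_oper := ClosedOper {
  closed_oper_fun :> H -> H; closed_operP : closed_oper_fun \in norm_closure }.

HB.instance Definition _ := [isSub for closed_oper_fun].
HB.instance Definition _ := [Choice of closed_oper by <:].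
HB.instance Definition _ := [SubChoice_isSubLmodule of closed_oper by <:].

Implicit Types f g : closed_oper.

Lemma closed_oper_eq f g : f =1 g -> f = g.
Proof. by move=> fg; apply/val_inj/funext. Qed.

Lemma closed_operD f g x : (f + g) x = f x + g x. Proof. by []. Qed.
Lemma closed_operZ c f x : (c *: f) x = c *: f x. Proof. by []. Qed.
Lemma closed_oper_approx f (e : C) : 0 < e ->
  exists2 b, S b & op_bound (fun x => f x - b x) e.
Proof. by move=> e0; have /norm_closureP/(_ _ e0) := closed_operP f. Qed.

Lemma closed_oper_bounded f : exists K, op_bound f K.
Proof.
have [b Sb [_ fb]] := closed_oper_approx f ltr01.
have [K [K0 bK]] := oper_bounded Sb; exists (1 + K); split=> [|x]; first exact: addr_ge0.
rewrite -[f x](subrK (b x)) mulrDl.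
by apply: (le_trans (ler_normD _ _)); rewrite lerD.
Qed.

Lemma closed_oper_linear f : linear f.
Proof.
move=> c x y; apply/eqP; rewrite -subr_eq0; apply/eqP.
apply: (@eq0_hseq _ _ _ (`|c *: x + y| + `|c| * `|x| + `|y|)).
  by rewrite !addr_ge0// mulr_ge0.
move=> n; have [b Sb [_ fb]] := closed_oper_approx f (hseq_gt0 R n).
have -> : f (c *: x + y) - (c *: f x + f y) =
    (f (c *: x + y) - b (c *: x + y)) - c *: (f x - b x) - (f y - b y).
  rewrite (oper_linear Sb) scalerBr !opprD !opprK !addrA.
  by rewrite [RHS](ACl (1*4*6*(2*5)*(3*7)))/= !addNr !addr0.
rewrite !mulrDl; apply: (le_trans (ler_normB _ _)); apply: lerD; last first.
  by rewrite mulrC fb.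
apply: (le_trans (ler_normB _ _)); apply: lerD; first by rewrite mulrC fb.
by rewrite normrZ -mulrA ler_wpM2l// mulrC fb.
Qed.

Lemma closed_operM_subproof f g : (f \o g : H -> H) \in norm_closure.
Proof.
apply/norm_closureP => e e0.
have [h h0 eh] : exists2 h, 0 < h & e = h + h.
  by exists (e / 2); rewrite ?divr_gt0// -splitr.
have [M [M0 gM]] := closed_oper_bounded g.
have M1 : 0 < M + 1 by rewrite ltr_wpDl.
have [b Sb [_ fb]] := closed_oper_approx f (divr_gt0 h0 M1).
have [K [K0 bK]] := oper_bounded Sb.
have K1 : 0 < K + 1 by rewrite ltr_wpDl.
(* [b'] is chosen after [b], because its precision depends on the bound of [b]. *)
have [b' Sb' [_ gb']] := closed_oper_approx g (divr_gt0 h0 K1).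
exists (b \o b'); first exact: operM.
split=> [|x]; first exact: ltW.
have bB y z : b (y - z) = b y - b z.
  by have := oper_linear Sb (-1) z y; rewrite !scaleN1r ![- _ + _]addrC.
have -> : (f \o g) x - (b \o b') x = (f (g x) - b (g x)) + b (g x - b' x).
  by rewrite bB /= addrA subrK.
apply: (le_trans (ler_normD _ _)); rewrite [in leRHS]eh mulrDl lerD//.
  apply: (le_trans (fb _)); rewrite -mulrA ler_wpM2l ?(ltW h0)//.
  rewrite mulrC ler_pdivrMr// mulrC; apply: (le_trans (gM x)).
  by rewrite ler_wpM2r// lerDl.
apply: (le_trans (bK _)); apply: (@le_trans _ _ ((K + 1) * `|g x - b' x|)).
  by rewrite ler_wpM2r// lerDl.
by rewrite mulrC -ler_pdivlMr//; apply: (le_trans (gb' x)); rewrite mulrAC.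
Qed.

Definition closed_oper_mul f g : closed_oper := ClosedOper (closed_operM_subproof f g).

(** The Riesz theorem is bypassed: approximants of [f] have adjoints in [S], whose mutual distances
    obey the same bounds by [op_adjoint_bound], and the pointwise limit of these adjoints is the
    adjoint of [f]. *)
Lemma closed_oper_adjoint f : exists g : closed_oper, op_adjoint f g.
Proof.
have /choice[b hb] : forall n, exists b, S b /\ op_bound (fun x => f x - b x) (hseq R n).
  by move=> n; have [b ? ?] := closed_oper_approx f (hseq_gt0 R n); exists b.
have /choice[a ha] : forall n, exists a, S a /\ op_adjoint (b n) a.
  by move=> n; have [Sb _] := hb n; have [a ? ?] := oper_adjoint Sb; exists a.
have ab n m : op_bound (fun x => a n x - a m x) (hseq R n + hseq R m).
  apply: (@op_adjoint_bound _ _ (fun x => b n x - b m x)).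
    by apply: op_adjoint_sub; [case: (ha n) | case: (ha m)].
  split=> [|x]; first by rewrite addr_ge0// hseq_ge0.
  have -> : b n x - b m x = (f x - b m x) - (f x - b n x).
    by rewrite opprB [RHS]addrC addrA subrK.
  apply: (le_trans (ler_normB _ _)); rewrite mulrDl addrC lerD//.
    by case: (hb n) => _ [].
  by case: (hb m) => _ [].
have /choice[g hg] : forall x, exists l, forall n, `|a n x - l| <= 4 * `|x| * hseq R n.
  move=> x; apply: (complete_fast (V := H)) => n m.
  by rewrite mulrC; have [_] := ab n m; exact.
have fg : op_adjoint f g.
  move=> x y; apply/eqP; rewrite -subr_eq0; apply/eqP.
  apply: (@eq0_hseq _ _ _ (5 * (`|x| * `|y|))); first by rewrite !mulr_ge0.
  move=> n; have [_ an] := ha n; have [_ [_ fb]] := hb n.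
  have -> : hdot H (f x) y - hdot H x (g y) =
      hdot H (f x - b n x) y + hdot H x (a n y - g y).
    by rewrite hdotBl hdotBr an addrA subrK.
  apply: (le_trans (ler_normD _ _)).
  have h1 : `|hdot H (f x - b n x) y| <= hseq R n * (`|x| * `|y|).
    by apply: (le_trans (hdot_le _ _)); rewrite mulrA ler_wpM2r.
  have h2 : `|hdot H x (a n y - g y)| <= `|x| * (4 * `|y| * hseq R n).
    by apply: (le_trans (hdot_le _ _)); rewrite ler_wpM2l.
  apply: (le_trans (lerD h1 h2)).
  by rewrite le_eqVlt; apply/orP; left; apply/eqP; ring.
suff gP : g \in norm_closure by exists (ClosedOper gP).
apply/norm_closureP => e e0.
have [n /(_ _ (leqnn _)) hn] := hseq_small e0.
have [Sa an] := ha n; exists (a n) => //.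
have [Sb [_ fb]] := hb n.
apply: (@op_adjoint_bound _ _ (fun x => f x - b n x)); first exact: op_adjoint_sub.
split=> [|x]; first exact: ltW.
by apply: (le_trans (fb x)); rewrite ler_wpM2r// ltW.
Qed.

Definition closed_oper_star f : closed_oper := projT1 (cid (closed_oper_adjoint f)).

Lemma closed_oper_starP f : op_adjoint f (closed_oper_star f).
Proof. by rewrite /closed_oper_star; case: cid. Qed.

Lemma closed_oper_starE f g : op_adjoint f g -> closed_oper_star f = g.
Proof.
move=> fg; apply: val_inj; apply: op_adjoint_unique fg.
exact: closed_oper_starP.
Qed.

Definition closed_oper_norm f : C := op_norm f.

Lemma closed_oper_normP f : op_bound f (closed_oper_norm f).
Proof. by have [K fK] := closed_oper_bounded f; case: (op_normP fK). Qed.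

Lemma closed_oper_norm_le f K : op_bound f K -> closed_oper_norm f <= K.
Proof. by move=> fK; case: (op_normP fK) => _; apply. Qed.

Lemma closed_oper_normD f g :
  closed_oper_norm (f + g) <= closed_oper_norm f + closed_oper_norm g.
Proof.
have [f0 hf] := closed_oper_normP f; have [g0 hg] := closed_oper_normP g.
apply: closed_oper_norm_le; split=> [|x]; first exact: addr_ge0.
by rewrite mulrDl; apply: (le_trans (ler_normD _ _)); rewrite lerD.
Qed.

Lemma closed_oper_normZ c f : closed_oper_norm (c *: f) = `|c| * closed_oper_norm f.
Proof.
have le d h : closed_oper_norm (d *: h) <= `|d| * closed_oper_norm h.
  have [h0 hh] := closed_oper_normP h.
  apply: closed_oper_norm_le; split=> [|x]; first exact: mulr_ge0.
  by rewrite closed_operZ normrZ -mulrA ler_wpM2l.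
apply/eqP; rewrite eq_le le /=.
have [->|c0] := eqVneq c 0.
  by rewrite normr0 mul0r; case: (closed_oper_normP (0 *: f)).
have nc : 0 < `|c| by rewrite normr_gt0.
rewrite -ler_pdivlMl// -normfV.
by have := le c^-1 (c *: f); rewrite scalerA mulVf// scale1r.
Qed.

Lemma closed_oper_norm_eq0 f : closed_oper_norm f = 0 -> f = 0.
Proof.
move=> f0; apply: closed_oper_eq => x; apply/eqP.
rewrite -normr_le0; have [_] := closed_oper_normP f.
by rewrite f0 => /(_ x); rewrite mul0r.
Qed.

HB.instance Definition _ := Lmodule_isNormed.Build C closed_oper
  closed_oper_normD closed_oper_normZ closed_oper_norm_eq0.

Lemma closed_oper_le f x : `|f x| <= `|f| * `|x|.
Proof. by case: (closed_oper_normP f). Qed.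

Lemma closed_oper_fast_complete : fast_complete closed_oper.
Proof.
move=> K u cu; have K0 := fast_cauchy_ge0 cu.
have /choice[g hg] : forall x, exists l, forall n, `|u n x - l| <= 4 * (K * `|x|) * hseq R n.
  move=> x; apply: (complete_fast (V := H)) => n m.
  apply: (le_trans (closed_oper_le (u n - u m) x)).
  by rewrite mulrAC ler_wpM2r//; exact: cu.
have ug n : op_bound (fun x => u n x - g x) (4 * K * hseq R n).
  split=> [|x]; first by rewrite !mulr_ge0// hseq_ge0.
  by apply: (le_trans (hg x n)); rewrite le_eqVlt; apply/orP; left; apply/eqP; ring.
have gP : g \in norm_closure.
  apply/norm_closureP => e e0.
  have e2 : 0 < e / 2 by rewrite divr_gt0.
  have K4 : 0 < 4 * K + 1 by rewrite ltr_wpDl// mulr_ge0.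
  have [n /(_ _ (leqnn _)) hn] := hseq_small (divr_gt0 e2 K4).
  have [b Sb [_ ub]] := closed_oper_approx (u n) e2; exists b => //.
  split=> [|x]; first exact: ltW.
  have -> : g x - b x = (u n x - b x) - (u n x - g x).
    by rewrite opprB [RHS]addrC addrA subrK.
  apply: (le_trans (ler_normB _ _)); rewrite [e in leRHS]splitr mulrDl lerD//.
  have [_ /(_ x) h] := ug n; apply: (le_trans h); rewrite ler_wpM2r//.
  rewrite ltr_pdivlMr// mulrC in hn; apply: le_trans (ltW hn).
  by rewrite ler_wpM2r ?hseq_ge0// lerDl.
exists (ClosedOper gP) => n; exact: (@closed_oper_norm_le (u n - ClosedOper gP) _ (ug n)).
Qed.

HB.instance Definition _ := Uniform_isComplete.Build closed_oper
  (fast_complete_cvg closed_oper_fast_complete).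

Lemma closed_oper_mul_linearl g : linear (closed_oper_mul^~ g).
Proof. by move=> c f f'; apply: closed_oper_eq. Qed.

Lemma closed_oper_mul_linearr f : linear (closed_oper_mul f).
Proof. by move=> c g g'; apply: closed_oper_eq => x /=; rewrite closed_oper_linear. Qed.

Lemma closed_oper_normM f g : `|closed_oper_mul f g| <= `|f| * `|g|.
Proof.
apply: closed_oper_norm_le; split=> [|x]; first exact: mulr_ge0.
by apply: (le_trans (closed_oper_le f (g x))); rewrite -mulrA ler_wpM2l// closed_oper_le.
Qed.

Lemma closed_oper_starK : involutive closed_oper_star.
Proof. by move=> f; exact/closed_oper_starE/op_adjoint_sym/closed_oper_starP. Qed.

Lemma closed_oper_star_antilinear (c : C) f g :
  closed_oper_star (c *: f + g) = c^* *: closed_oper_star f + closed_oper_star g.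
Proof.
apply: closed_oper_starE => x y; rewrite !closed_operD !closed_operZ.
by rewrite hdotDl hdotZl hdotDr hdotZr conjCK !closed_oper_starP.
Qed.

Lemma closed_oper_starM f g :
  closed_oper_star (closed_oper_mul f g) =
  closed_oper_mul (closed_oper_star g) (closed_oper_star f).
Proof. by apply: closed_oper_starE => x y /=; rewrite !closed_oper_starP. Qed.

Lemma closed_oper_star_norm f : `|closed_oper_mul (closed_oper_star f) f| = `|f| ^+ 2.
Proof.
have star_le h : `|closed_oper_star h| <= `|h|.
  apply: closed_oper_norm_le; apply: op_adjoint_bound (closed_oper_starP h) _.
  exact: closed_oper_normP.
apply/eqP; rewrite eq_le; apply/andP; split.
  by apply: (le_trans (closed_oper_normM _ _)); rewrite expr2 ler_wpM2r.
set t := closed_oper_mul _ _.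
(* The reverse inequality: the square root of the norm of [t] bounds [f], since the square of the
   norm of [f x] is the inner product of [t x] with [x]. *)
have t0 : 0 <= sqrtC `|t| by rewrite sqrtC_ge0.
rewrite -[leRHS]sqrtCK ler_pXn2r ?nnegrE//; apply: closed_oper_norm_le; split=> // x.
rewrite -(@ler_pXn2r _ 2) ?nnegrE ?mulr_ge0// exprMn sqrtCK.
rewrite -[leLHS]ger0_norm ?exprn_ge0// -hdot_norm closed_oper_starP.
apply: (le_trans (hdot_le _ _)); rewrite mulrC expr2 mulrA ler_wpM2r//.
exact: (closed_oper_le t x).
Qed.

Lemma closed_oper_mulA : associative closed_oper_mul.
Proof. by move=> f g h; exact: closed_oper_eq. Qed.

Definition closure_cstar : cstarAlgebra R :=
  @CStarAlgebra R closed_oper closed_oper_mul closed_oper_star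
    closed_oper_mulA
    closed_oper_mul_linearl closed_oper_mul_linearr closed_oper_normM closed_oper_starK
    closed_oper_star_antilinear closed_oper_starM closed_oper_star_norm.

End NormClosure.

(** * Pairings of elementary abelian 2-groups *)

HB.instance Definition _ (Q Q' : finZmodType) := Finite.on (Q * Q')%type.

Record pairing (D L : zmodType) := Pairing {
  pairing_fun :> D -> L -> bool;
  pairDl : forall x y l, pairing_fun (x + y) l = pairing_fun x l (+) pairing_fun y l;
  pairDr : forall x l m, pairing_fun x (l + m) = pairing_fun x l (+) pairing_fun x m;
  addDD : forall x : D, x + x = 0;
  addLL : forall l : L, l + l = 0;
  pair_ndl : forall x, x != 0 -> exists l, pairing_fun x l;
  pair_ndr : forall l, l != 0 -> exists x, pairing_fun x l
}.

Section PairingTheory.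
Variables (D L : zmodType) (b : pairing D L).

Lemma pair0l l : b 0 l = false.
Proof. by rewrite -(addDD b 0) pairDl addbb. Qed.

Lemma pair0r x : b x 0 = false.
Proof. by rewrite -(addLL b 0) pairDr addbb. Qed.

Lemma addDK x y : x + y + y = x :> D.
Proof. by rewrite -addrA (addDD b) addr0. Qed.

Lemma addLK l m : l + m + m = l :> L.
Proof. by rewrite -addrA (addLL b) addr0. Qed.

(* [Q] indexes finite subgroups of [D] and of [L] in perfect duality. *)
Record dual_pair := DualPair {
  dpQ : finZmodType;
  dpl : dpQ -> D;
  dpr : dpQ -> L;
  dplD : forall p q, dpl (p + q) = dpl p + dpl q;
  dprD : forall p q, dpr (p + q) = dpr p + dpr q;
  dpQ2 : forall p : dpQ, p + p = 0;
  dp_reprl : forall chi : dpQ -> bool, (forall p q, chi (p + q) = chi p (+) chi q) ->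
    exists q, forall p, chi p = b (dpl p) (dpr q);
  dp_reprr : forall chi : dpQ -> bool, (forall p q, chi (p + q) = chi p (+) chi q) ->
    exists p, forall q, chi q = b (dpl p) (dpr q);
  dp_ndl : forall p, p != 0 -> exists q, b (dpl p) (dpr q);
  dp_ndr : forall q, q != 0 -> exists p, b (dpl p) (dpr q)
}.

Lemma dp0l (P : dual_pair) : @dpl P 0 = 0.
Proof. by rewrite -[in LHS](dpQ2 (0 : dpQ P)) dplD (addDD b). Qed.

Lemma dp0r (P : dual_pair) : @dpr P 0 = 0.
Proof. by rewrite -[in LHS](dpQ2 (0 : dpQ P)) dprD (addLL b). Qed.

Definition dp_mem (P : dual_pair) (t : D * L) :=
  exists p q : dpQ P, t = (dpl p, dpr q).

Definition dp_le (P P' : dual_pair) := forall t, dp_mem P t -> dp_mem P' t.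

Lemma dual_pair0 : exists P : dual_pair, dp_mem P (0, 0).
Proof.
(* A one-point group, obtained as vectors of length 0 over the field with two elements. *)
pose Q : finZmodType := 'rV[bool]_0.
have Q0 (p : Q) : p = 0 by rewrite [p]thinmx0.
have chi0 (chi : Q -> bool) : (forall p q, chi (p + q) = chi p (+) chi q) ->
    forall p, chi p = false.
  by move=> chiD p; rewrite (Q0 p) -(addr0 0) chiD addbb.
unshelve eexists (@DualPair Q (fun=> 0) (fun=> 0) _ _ _ _ _ _ _).
- by move=> *; rewrite addr0.
- by move=> *; rewrite addr0.
- by move=> p; rewrite [LHS]Q0.
- by move=> chi /chi0 h; exists 0 => p; rewrite h pair0l.
- by move=> chi /chi0 h; exists 0 => p; rewrite h pair0l.
- by move=> p; rewrite (Q0 p) eqxx.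
- by move=> p; rewrite (Q0 p) eqxx.
- by exists 0, 0.
Qed.

(** The new pair is orthogonal to the old one and pairs to 1 with itself, so the form on
    [dpQ P * bool] is an orthogonal sum. A character of the product is fixed by its restriction to
    [dpQ P] and its value at [(0, true)], and each part is represented separately. *)
Lemma dual_pair_extend (P : dual_pair) d l :
  (forall q, b d (@dpr P q) = false) -> (forall p, b (@dpl P p) l = false) -> b d l ->
  exists P', dp_le P P' /\ forall p q : dpQ P,
    dp_mem P' (dpl p + d, dpr q) /\ dp_mem P' (dpl p, dpr q + l).
Proof.
move=> dQ Ql dl; pose Q' : finZmodType := (dpQ P * bool)%type.
pose il (p : Q') := dpl p.1 + (if p.2 then d else 0).
pose ir (q : Q') := dpr q.1 + (if q.2 then l else 0).
have bil p q : b (il p) (ir q) = b (dpl p.1) (dpr q.1) (+) (p.2 && q.2).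
  rewrite /il /ir pairDl !pairDr; case: p.2 q.2 => [] [] /=.
  - by rewrite Ql dQ dl addbF.
  - by rewrite !pair0r dQ !addbF.
  - by rewrite !pair0l Ql !addbF.
  - by rewrite !pair0l !pair0r !addbF.
have chiE (chi : Q' -> bool) : (forall p q, chi (p + q) = chi p (+) chi q) ->
    forall p, chi p = chi (p.1, false) (+) (p.2 && chi (0, true)).
  move=> chiD [p []] /=; last by rewrite addbF.
  by rewrite -chiD; congr chi; rewrite /GRing.add /=; congr pair; rewrite addr0.
have chi1 (chi : Q' -> bool) : (forall p q, chi (p + q) = chi p (+) chi q) ->
    forall p q, chi (p + q, false) = chi (p, false) (+) chi (q, false).
  by move=> chiD p q; rewrite -chiD.
unshelve eexists (@DualPair Q' il ir _ _ _ _ _ _ _).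
- move=> [p s] [q t]; rewrite /il /= dplD addrACA; congr (_ + _).
  by case: s t => [] [] /=; rewrite ?(addDD b) ?addr0 ?add0r.
- move=> [p s] [q t]; rewrite /ir /= dprD addrACA; congr (_ + _).
  by case: s t => [] [] /=; rewrite ?(addLL b) ?addr0 ?add0r.
- by move=> [p s]; congr pair; [exact: dpQ2 | case: s].
- move=> chi chiD; have [q hq] := dp_reprl (chi1 _ chiD).
  by exists (q, chi (0, true)) => p; rewrite bil chiE// hq.
- move=> chi chiD; have [q hq] := dp_reprr (chi1 _ chiD).
  by exists (q, chi (0, true)) => p; rewrite bil chiE// hq andbC.
- move=> [p s]; have [-> /=|p0 _] := eqVneq p 0.
    by case: s => [_|]; [exists (0, true); rewrite bil /= dp0l pair0l | rewrite eqxx].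
  by have [q hq] := dp_ndl p0; exists (q, false); rewrite bil /= hq andbF.
- move=> [p s]; have [-> /=|p0 _] := eqVneq p 0.
    by case: s => [_|]; [exists (0, true); rewrite bil /= dp0l pair0l | rewrite eqxx].
  by have [q hq] := dp_ndr p0; exists (q, false); rewrite bil /= hq.
split=> [t [p [q ->]]|p q].
  by exists (p, false), (q, false); rewrite /= /il /ir !addr0.
split.
  by exists (p, true), (q, false); rewrite /= /il /ir !addr0.
by exists (p, false), (q, true); rewrite /= /il /ir !addr0.
Qed.

(** Perfect duality represents the character of [l] by some [dpr q], so [l' = l + dpr q] is
    orthogonal to the old subgroup of [D]. If [l'] is 0, then [l] was there already. Otherwise a
    partner [d] is corrected in the same way; its pairing with [l'] survives because [l']
    annihilates the correction. *)
Lemma dual_pair_addr (P : dual_pair) l : exists P', dp_le P P' /\ dp_mem P' (0, l).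
Proof.
have [|q hq] := @dp_reprl P (fun p => b (dpl p) l).
  by move=> p p'; rewrite dplD pairDl.
pose l' := l + dpr q.
have [l0|/(pair_ndr b)[d dl]] := eqVneq l' 0.
  exists P; split=> //; exists 0, q; rewrite dp0l; congr pair.
  by rewrite -[l](addLK _ (dpr q)) -/l' l0 add0r.
have [|p hp] := @dp_reprr P (fun q => b d (dpr q)).
  by move=> ? ?; rewrite dprD pairDr.
have Ql (p' : dpQ P) : b (dpl p') l' = false by rewrite pairDr hq addbb.
have [||| P' [PP' hP']] := @dual_pair_extend P (d + dpl p) l'.
- by move=> q'; rewrite pairDl hp addbb.
- exact: Ql.
- by rewrite pairDl dl Ql.
exists P'; split=> //; have [_] := hP' 0 q.
by rewrite dp0l addrC addLK.
Qed.

Lemma dual_pair_addl (P : dual_pair) d : exists P', dp_le P P' /\ dp_mem P' (d, 0).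
Proof.
have [|p hp] := @dp_reprr P (fun q => b d (dpr q)).
  by move=> ? ?; rewrite dprD pairDr.
pose d' := d + dpl p.
have [d0|/(pair_ndl b)[l dl]] := eqVneq d' 0.
  exists P; split=> //; exists p, 0; rewrite dp0r; congr pair.
  by rewrite -[d](addDK _ (dpl p)) -/d' d0 add0r.
have [|q hq] := @dp_reprl P (fun p => b (dpl p) l).
  by move=> ? ?; rewrite dplD pairDl.
have Qd (q' : dpQ P) : b d' (dpr q') = false by rewrite pairDl hp addbb.
have [||| P' [PP' hP']] := @dual_pair_extend P d' (l + dpr q).
- exact: Qd.
- by move=> p'; rewrite pairDr hq addbb.
- by rewrite pairDr dl Qd.
exists P'; split=> //; have [+ _] := hP' p 0.
by rewrite dp0r addrC addDK.
Qed.

Lemma dual_pair_cover (s : seq (D * L)) : exists P, forall t, t \in s -> dp_mem P t.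
Proof.
elim: s => [|[d l] s [P hP]]; first by have [P _] := dual_pair0; exists P.
have [P1 [PP1 [p [q dE]]]] := dual_pair_addl P d.
have [P2 [P12 [p' [q' lE]]]] := dual_pair_addr P1 l.
exists P2 => t; rewrite inE => /orP[/eqP ->|/hP/PP1/P12//].
have [p2 [q2 dE2]] : dp_mem P2 (d, 0) by apply: P12; exists p, q.
by exists p2, q'; case: dE2 lE => -> _ [_ ->].
Qed.

Variable R : realType.
Local Notation C := R[i].

(** For nonzero [p], translation by some [r] with sign -1 permutes the terms and negates the sum. *)
Lemma dp_orthogonal_r (P : dual_pair) (p : dpQ P) :
  \sum_(q : dpQ P) sg R (b (dpl p) (dpr q)) = #|dpQ P|%:R *+ (p == 0).
Proof.
have [->|/dp_ndl[r hr]] := eqVneq p 0.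
  by under eq_bigr do rewrite dp0l pair0l; rewrite sumr_const mulr1n.
set S := \sum_q _; rewrite mulr0n; apply/eqP.
have : S = - S.
  rewrite {1}/S (reindex_inj (addrI r)) /= -sumrN; apply: eq_bigr => q _.
  by rewrite dprD pairDr sgD hr /sg expr1 mulN1r.
by move/eqP; rewrite -addr_eq0 -mulr2n mulrn_eq0.
Qed.

Lemma dp_orthogonal_l (P : dual_pair) (q : dpQ P) :
  \sum_(p : dpQ P) sg R (b (dpl p) (dpr q)) = #|dpQ P|%:R *+ (q == 0).
Proof.
have [->|/dp_ndr[r hr]] := eqVneq q 0.
  by under eq_bigr do rewrite dp0r pair0r; rewrite sumr_const mulr1n.
set S := \sum_p _; rewrite mulr0n; apply/eqP.
have : S = - S.
  rewrite {1}/S (reindex_inj (addrI r)) /= -sumrN; apply: eq_bigr => p _.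
  by rewrite dplD pairDl sgD hr /sg expr1 mulN1r.
by move/eqP; rewrite -addr_eq0 -mulr2n mulrn_eq0.
Qed.

End PairingTheory.

(** * The Weyl algebra of a pairing *)

Section Weyl.
Variables (R : realType) (D L : zmodType) (b : pairing D L).
Local Notation C := R[i].
Local Notation I := (D + L)%type.
Local Notation H := (ell2 R I).
Local Notation Hh := (ell2_hilbert R I).
Local Notation sg := (sg R).

Definition shift d l (i : I) : option I :=
  Some match i with inl x => inl (x + d) | inr y => inr (y + l) end.

Lemma shiftK d l : partial_inverse (shift d l) (shift d l).
Proof.
move=> [x|y] [x'|y'] //; apply/eqP/eqP; rewrite /shift => -[].
- by move=> <-; rewrite (addDK b).
- by move=> <-; rewrite (addDK b).
- by move=> <-; rewrite (addLK b).
- by move=> <-; rewrite (addLK b).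
Qed.

(** The summand [+ l] records that on [ell2 L] the character acts before the translation. With this
    order both summands have the same cocycle [b d l'] in [weylM]; with the other order [ell2 L]
    would give [b d' l]. *)
Definition wsign d l (i : I) : bool :=
  match i with inl x => b x l | inr y => b d (y + l) end.

(* On [ell2 D], translate by [d] and then multiply by the character of [l]; on
   [ell2 L], multiply by the character of [d] and then translate by [l]. *)
Definition weyl d l : H -> H := pull (shiftK d l) (wsign d l).

Lemma weylEl d l f x : weyl d l f (inl x) = sg (b x l) * f (inl (x + d)).
Proof. by []. Qed.

Lemma weylEr d l f y : weyl d l f (inr y) = sg (b d (y + l)) * f (inr (y + l)).
Proof. by []. Qed.

Lemma weyl_linear d l : linear (weyl d l).
Proof. exact: pull_linear. Qed.

Lemma weyl0 f : weyl 0 0 f = f.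
Proof.
apply: ell2_eq => -[x|y]; first by rewrite weylEl pair0r mul1r addr0.
by rewrite weylEr pair0l mul1r addr0.
Qed.

Lemma weylM d l d' l' f :
  weyl d l (weyl d' l' f) = sg (b d l') *: weyl (d + d') (l + l') f.
Proof.
apply: ell2_eq => -[x|y]; rewrite ell2Z.
  rewrite !weylEl !mulrA -!sgD addrA; congr (sg _ * _).
  by rewrite pairDl pairDr; do 3 case: (b _ _).
rewrite !weylEr !mulrA -!sgD !addrA; congr (sg _ * _).
by rewrite !pairDr !pairDl; do 6 case: (b _ _).
Qed.

Lemma weyl_bound d l : op_bound (weyl d l : Hh -> Hh) 1.
Proof. by split=> // f; rewrite mul1r; exact: pull_norm_le. Qed.

(** By [weylM] the unitary squares to the scalar [sg (b d l)], so it is its own inverse up to that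
    sign. *)
Lemma weyl_adjoint d l : op_adjoint (weyl d l : Hh -> Hh)
  (fun f => sg (b d l) *: weyl d l f).
Proof.
move=> f g; rewrite [LHS](@pull_adjoint _ _ _ _ _ (shiftK d l) _
  (fun i => b d l (+) wsign d l i)).
  congr (ell2_dot f _); apply: ell2_eq => -[x|y]; rewrite ell2Z pullE /=.
    by rewrite sgD mulrA.
  by rewrite sgD mulrA.
move=> [x|y] j /= [<-] /=; first by rewrite pairDl addbCA addbb addbF.
by rewrite !pairDr; do 2 case: (b _ _).
Qed.

Inductive weyl_span : (Hh -> Hh) -> Prop :=
| weyl_span0 : weyl_span 0
| weyl_spanS (c : C) d l f : weyl_span f -> weyl_span (c *: (weyl d l : Hh -> Hh) + f).

Lemma weyl_spanL c f g : weyl_span f -> weyl_span g -> weyl_span (c *: f + g).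
Proof.
move=> hf hg; elim: hf => [|e d l f' _ IH]; first by rewrite scaler0 add0r.
by rewrite scalerDr scalerA -addrA; exact: weyl_spanS.
Qed.

Lemma weyl_span_linear f : weyl_span f -> linear f.
Proof.
elim=> [c x y|e d l f' _ IH c x y]; first by rewrite -[RHS]/(c *: (0 : Hh) + 0) scaler0 addr0.
rewrite !fctE IH weyl_linear !scalerDr !scalerA -!addrA; congr (_ + _).
  by rewrite mulrC.
by rewrite addrCA.
Qed.

Lemma weyl_span_bounded f : weyl_span f -> exists K, op_bound f K.
Proof.
elim=> [|e d l f' _ [K [K0 fK]]].
  by exists 0; split=> // x; rewrite mul0r normr_le0.
exists (`|e| + K); split=> [|x]; first exact: addr_ge0.
rewrite !fctE; apply: (le_trans (ler_normD _ _)); rewrite mulrDl lerD// normrZ.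
rewrite ler_wpM2l//; have [_ h] := weyl_bound d l.
by apply: (le_trans (h x)); rewrite mul1r.
Qed.

Lemma weyl_span_adjoint f : weyl_span f -> exists2 g, weyl_span g & op_adjoint f g.
Proof.
elim=> [|e d l f' _ [g gs fg]].
  exists 0; first exact: weyl_span0.
  move=> x y; rewrite -[LHS]/(hdot _ (0 : Hh) y).
  rewrite -[RHS]/(hdot _ x (0 : Hh)).
  by rewrite -{1}(scale0r x) hdotZl mul0r -(scale0r y) hdotZr conjC0 mul0r.
exists ((e^* * sg (b d l)) *: (weyl d l : Hh -> Hh) + g); first exact: weyl_spanS.
move=> x y; rewrite !fctE hdotDl hdotDr fg; congr (_ + _).
by rewrite hdotZl weyl_adjoint -[in RHS]scalerA [RHS]hdotZr conjCK.
Qed.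

Lemma weyl_spanM f g : weyl_span f -> weyl_span g -> weyl_span (f \o g).
Proof.
move=> hf hg; elim: hf => [|e d l f' _ IH]; first exact: weyl_span0.
have -> : (e *: (weyl d l : Hh -> Hh) + f') \o g =
    e *: (weyl d l \o g) + (f' \o g) by [].
apply: weyl_spanL => //; elim: hg => [|e' d' l' g' _ IH'].
  have -> : weyl d l \o (0 : Hh -> Hh) = 0 :> (Hh -> Hh); last exact: weyl_span0.
  apply/funext => x; have h : weyl d l 0 = 0.
    by apply: ell2_eq => -[z|z]; rewrite ?weylEl ?weylEr !ell20 mulr0.
  exact: h.
have -> : weyl d l \o (e' *: (weyl d' l' : Hh -> Hh) + g') =
    (e' * sg (b d l')) *: (weyl (d + d') (l + l') : Hh -> Hh) + (weyl d l \o g').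
  by apply/funext => x; rewrite /= !fctE weyl_linear weylM scalerA.
exact: weyl_spanS.
Qed.

Definition weyl_algebra : operatorAlgebra (Hh) :=
  OperatorAlgebra weyl_span0 weyl_spanL weyl_spanM weyl_span_linear weyl_span_bounded
    weyl_span_adjoint.

End Weyl.

Arguments cmul : simpl never.
Arguments cstar : simpl never.

Section LinearPredicate.
Variables (K : nzRingType) (U V : lmodType K) (f : U -> V).
Hypothesis f_lin : linear f.

Lemma linear_pred0 : f 0 = 0.
Proof.
by have := f_lin (-1) 0 0; rewrite scaler0 add0r scaleN1r addNr.
Qed.

Lemma linear_predD x y : f (x + y) = f x + f y.
Proof. by have := f_lin 1 x y; rewrite !scale1r. Qed.

Lemma linear_predZ c x : f (c *: x) = c *: f x.
Proof. by have := f_lin c x 0; rewrite linear_pred0 !addr0. Qed.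

Lemma linear_predB x y : f (x - y) = f x - f y.
Proof. by rewrite -scaleN1r addrC f_lin scaleN1r addrC. Qed.

Lemma linear_pred_sum (J : Type) (s : seq J) (P : pred J) (F : J -> U) :
  f (\sum_(j <- s | P j) F j) = \sum_(j <- s | P j) f (F j).
Proof. exact: (big_morph f linear_predD linear_pred0). Qed.

End LinearPredicate.

Section CstarSums.
Variables (R : realType) (A : cstarAlgebra R).
Implicit Types (x y : A).

Lemma cmulZl c x y : cmul (c *: x) y = c *: cmul x y.
Proof. exact: (linear_predZ (@cmul_linearl R A y)). Qed.

Lemma cmulZr c x y : cmul x (c *: y) = c *: cmul x y.
Proof. exact: (linear_predZ (@cmul_linearr R A x)). Qed.

Lemma cmul_suml (J : Type) (s : seq J) (P : pred J) (F : J -> A) y :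
  cmul (\sum_(j <- s | P j) F j) y = \sum_(j <- s | P j) cmul (F j) y.
Proof. exact: (linear_pred_sum (@cmul_linearl R A y)). Qed.

Lemma cmul_sumr (J : Type) (s : seq J) (P : pred J) (F : J -> A) x :
  cmul x (\sum_(j <- s | P j) F j) = \sum_(j <- s | P j) cmul x (F j).
Proof. exact: (linear_pred_sum (@cmul_linearr R A x)). Qed.

Lemma cmulBl x y z : cmul (x - y) z = cmul x z - cmul y z.
Proof. by have := @cmul_linearl R A z (-1) y x; rewrite !scaleN1r ![- _ + _]addrC. Qed.

Lemma cmulBr x y z : cmul z (x - y) = cmul z x - cmul z y.
Proof. by have := @cmul_linearr R A z (-1) y x; rewrite !scaleN1r ![- _ + _]addrC. Qed.

Lemma cstarD x y : cstar (x + y) = cstar x + cstar y.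
Proof. by have := cstar_antilinear 1 x y; rewrite !scale1r conjC1 scale1r. Qed.

Lemma cstar0 : cstar (0 : A) = 0.
Proof. by have := cstarD 0 0; rewrite addr0 => /eqP; rewrite -subr_eq subrr eq_sym => /eqP. Qed.

Lemma cstarZ c x : cstar (c *: x) = c^* *: cstar x.
Proof. by have := cstar_antilinear c x 0; rewrite !addr0 cstar0 addr0. Qed.

Lemma cstar_sum (J : Type) (s : seq J) (P : pred J) (F : J -> A) :
  cstar (\sum_(j <- s | P j) F j) = \sum_(j <- s | P j) cstar (F j).
Proof. exact: (big_morph _ cstarD cstar0). Qed.

End CstarSums.

(** * Matrix units attached to a dual pair *)

Section MatrixUnits.
Variables (R : realType) (D L : zmodType) (b : pairing D L).
Local Notation C := R[i].
Local Notation I := (D + L)%type.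
Local Notation H := (ell2_hilbert R I).
Local Notation sg := (sg R).
Local Notation S := (weyl_algebra R b).

Definition weyl_cstar : cstarAlgebra R := closure_cstar S.
Local Notation B := weyl_cstar.

Definition act (x : B) : H -> H := closed_oper_fun (x : closed_oper S).

Arguments act : simpl never.

Lemma act_eq (x y : B) : act x =1 act y -> x = y.
Proof. exact: closed_oper_eq. Qed.

Lemma act_mul (x y : B) v : act (cmul x y) v = act x (act y v). Proof. by []. Qed.
Lemma actD (x y : B) v : act (x + y) v = act x v + act y v. Proof. by []. Qed.
Lemma actN (x : B) v : act (- x) v = - act x v. Proof. by []. Qed.
Lemma actZ c (x : B) v : act (c *: x) v = c *: act x v. Proof. by []. Qed.
Lemma act0 v : act 0 v = 0. Proof. by []. Qed.

Lemma act_sum (J : Type) (s : seq J) (P : pred J) (F : J -> B) v :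
  act (\sum_(j <- s | P j) F j) v = \sum_(j <- s | P j) act (F j) v.
Proof. exact: (big_morph (fun x => act x v)). Qed.

Lemma act_linear x : linear (act x). Proof. exact: closed_oper_linear. Qed.

Lemma act_adjoint x : op_adjoint (act x) (act (cstar x)).
Proof. exact: closed_oper_starP. Qed.

Lemma act_le (x : B) v : `|act x v| <= `|x| * `|v|. Proof. exact: closed_oper_le. Qed.

Lemma act_norm_le (x : B) K : op_bound (act x) K -> `|x| <= K.
Proof. exact: closed_oper_norm_le. Qed.

Lemma weyl_oper d l : S (weyl b d l).
Proof.
have := weyl_spanS 1 d l (weyl_span0 R b); rewrite addr0 scale1r; exact.
Qed.

Definition weylc d l : B := ClosedOper (oper_norm_closure (weyl_oper d l)).

Lemma act_weylc d l v : act (weylc d l) v = weyl b d l v. Proof. by []. Qed.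

Lemma weylcM d l d' l' :
  cmul (weylc d l) (weylc d' l') = sg (b d l') *: weylc (d + d') (l + l').
Proof. by apply: act_eq => v; rewrite act_mul actZ !act_weylc weylM. Qed.

Lemma weylc_star d l : cstar (weylc d l) = sg (b d l) *: weylc d l.
Proof.
by apply: closed_oper_starE => v v'; rewrite [LHS]weyl_adjoint.
Qed.

Lemma act_weylc0 v : act (weylc 0 0) v = v.
Proof. exact: weyl0. Qed.

Lemma weylc0l x : cmul (weylc 0 0) x = x.
Proof. by apply: act_eq => v; rewrite act_mul act_weylc0. Qed.

Lemma weylc0r x : cmul x (weylc 0 0) = x.
Proof. by apply: act_eq => v; rewrite act_mul act_weylc0. Qed.

Lemma weylc_dense (x : B) e : 0 < e -> exists2 y : B, S (act y) & `|x - y| <= e.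
Proof.
move=> e0; have [f Sf [_ xf]] := closed_oper_approx x e0.
exists (ClosedOper (oper_norm_closure Sf)) => //.
by apply: act_norm_le; split=> [|v]; [exact: ltW | exact: xf].
Qed.

Variable P : dual_pair b.
Local Notation Q := (dpQ P).
Local Notation N := (#|Q|).
Implicit Types (p q r s t : Q).
Local Notation bQ p r := (b (@dpl _ _ _ P p) (@dpr _ _ _ P r)).

Lemma dp_card_neq0 : N%:R != 0 :> C.
Proof. by rewrite pnatr_eq0 -lt0n; apply/card_gt0P; exists 0. Qed.

Lemma dpQK p q : p + q + q = p.
Proof. by rewrite -addrA dpQ2 addr0. Qed.

Lemma dpQ_opp p : - p = p.
Proof. by apply/eqP; rewrite eq_sym -addr_eq0 dpQ2. Qed.

Definition wQ p r : B := weylc (dpl p) (dpr r).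

Lemma wQM p r q s : cmul (wQ p r) (wQ q s) = sg (bQ p s) *: wQ (p + q) (r + s).
Proof. by rewrite weylcM /wQ dplD dprD. Qed.

(** Averaging the characters against [sg (bQ p r)] gives their spectral projection at [p]; preceded
    by the translation by [p + q], which carries [q] to [p], it is the matrix unit with row [p] and
    column [q]. *)
Definition munit p q : B := N%:R^-1 *: \sum_r sg (bQ p r) *: wQ (p + q) r.

Arguments munit : simpl never.

Lemma munitM p q s t : cmul (munit p q) (munit s t) = munit p t *+ (q == s).
Proof.
rewrite /munit cmulZl cmulZr cmul_suml scalerA.
(* After reindexing by the total character [u], the operator no longer depends on [r]; the sum over
   [r] is a character sum that vanishes unless [q = s]. *)
transitivity ((N%:R^-1 * N%:R^-1) *:
  \sum_r \sum_u (sg (bQ p u) * sg (bQ (q + s) r)) *: wQ (p + q + (s + t)) u).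
  congr (_ *: _); under eq_bigr do rewrite cmul_sumr.
  rewrite exchange_big /= ; apply: eq_bigr => r _.
  rewrite (reindex_inj (addIr r)) /=; apply: eq_bigr => u _.
  rewrite cmulZl cmulZr wQM !scalerA dpQK; congr (_ *: _).
  rewrite -!sgD; congr sg.
  by rewrite !dplD !dprD !pairDr !pairDl; do 4 case: (bQ _ _).
rewrite exchange_big /=.
under eq_bigr do rewrite -scaler_suml -mulr_sumr dp_orthogonal_r.
have -> : (q + s == 0) = (q == s) by rewrite addr_eq0 dpQ_opp.
case: eqP => [->|_]; last first.
  by rewrite !mulr0n; under eq_bigr do rewrite mulr0 scale0r; rewrite big1 ?scaler0.
rewrite !mulr1n; under eq_bigr do rewrite mulrC -scalerA.
rewrite -scaler_sumr scalerA -mulrA mulVf ?dp_card_neq0// mulr1.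
by congr (_ *: _); apply: eq_bigr => u _; rewrite addrA dpQK.
Qed.

Lemma munit_star p q : cstar (munit p q) = munit q p.
Proof.
rewrite /munit cstarZ cstar_sum fmorphV rmorph_nat; congr (_ *: _).
apply: eq_bigr => r _; rewrite cstarZ sg_conj weylc_star scalerA -sgD /wQ.
rewrite [p + q]addrC; congr (sg _ *: _).
by rewrite dplD pairDl; do 2 case: (bQ _ _).
Qed.

Lemma munit_sum1 : \sum_p munit p p = weylc 0 0.
Proof.
rewrite /munit -scaler_sumr exchange_big /=.
under eq_bigr => r _ do under eq_bigr => p _ do rewrite dpQ2.
under eq_bigr do rewrite -scaler_suml dp_orthogonal_l.
rewrite (bigD1 0) //= eqxx mulr1n big1 ?addr0; last first.
  by move=> r /negbTE ->; rewrite mulr0n scale0r.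
by rewrite scalerA mulVf ?dp_card_neq0// scale1r /wQ (dp0l P) (dp0r P).
Qed.

(** Fourier inversion of the formula defining [munit]: the operators [wQ] lie in the span of the
    matrix units. *)
Lemma wQ_munit p r : wQ p r = \sum_t sg (bQ t r) *: munit t (t + p).
Proof.
rewrite /munit.
transitivity (N%:R^-1 *: \sum_u (\sum_t sg (bQ t (r + u))) *: wQ p u).
  under eq_bigr do rewrite dp_orthogonal_l.
  rewrite (bigD1 r) //= dpQ2 eqxx mulr1n big1 ?addr0; last first.
    by move=> u ur; rewrite addr_eq0 dpQ_opp eq_sym (negbTE ur) mulr0n scale0r.
  by rewrite scalerA mulVf ?dp_card_neq0// scale1r.
under eq_bigr do rewrite scaler_suml.
rewrite exchange_big /= scaler_sumr; apply: eq_bigr => t _.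
rewrite scalerA mulrC -scalerA; congr (_ *: _); rewrite scaler_sumr.
apply: eq_bigr => u _; rewrite scalerA -sgD dprD pairDr; congr (_ *: wQ _ _).
by rewrite addrA dpQ2 add0r.
Qed.

Definition dvec q : H := delta R (inl (dpl q)).

Lemma act_wQ_dvec p r t : act (wQ p r) (dvec t) = sg (bQ (p + t) r) *: dvec (p + t).
Proof.
apply: ell2_eq => -[x|y]; last by rewrite [LHS]weylEr ell2Z !deltaE !mulr0.
rewrite [LHS]weylEl ell2Z !deltaE.
have -> : (inl (x + dpl p) == inl (dpl t) :> I) = (inl x == inl (dpl (p + t)) :> I).
  apply/eqP/eqP => -[]; last by move=> ->; rewrite [p + t]addrC dplD (addDK b).
  by move=> E; congr inl; rewrite [p + t]addrC dplD -E (addDK b).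
by case: eqP => [[->]//|_]; rewrite !mulr0.
Qed.

Lemma act_munit_dvec p q t : act (munit p q) (dvec t) = dvec p *+ (q == t).
Proof.
rewrite /munit actZ act_sum.
transitivity (N%:R^-1 *: ((\sum_r sg (bQ (q + t) r)) *: dvec (p + q + t))).
  congr (_ *: _); rewrite scaler_suml; apply: eq_bigr => r _.
  rewrite actZ act_wQ_dvec scalerA -sgD !dplD !pairDl; congr (sg _ *: _).
  by do 3 case: (bQ _ _).
rewrite dp_orthogonal_r addr_eq0 dpQ_opp; case: eqP => [->|_]; last first.
  by rewrite mulr0n scale0r scaler0.
by rewrite !mulr1n scalerA mulVf ?dp_card_neq0// scale1r dpQK.
Qed.

End MatrixUnits.

Arguments act : simpl never.
Arguments munit : simpl never.

(** * Compressions to matrix algebras *)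

Section PositiveMatrices.
Variable R : realType.
Local Notation C := R[i].

Lemma adjmxE n (M : 'M[C]_n) i j : adjmx M i j = (M j i)^*.
Proof. by rewrite !mxE. Qed.

(** Diagonalise [P] by a unitary [U], take square roots of the eigenvalues, and multiply by [U]. *)
Lemma psd_factor n (P : 'M[C]_n) : (forall i j, P i j = (P j i)^*) ->
  (forall v : 'I_n -> C, 0 <= \sum_i \sum_j (v i)^* * P i j * v j) ->
  exists Z : 'M[C]_n, P = adjmx Z *m Z.
Proof.
move=> Pherm Ppsd.
have Padj : adjmx P = P by apply/matrixP => i j; rewrite adjmxE -Pherm.
have Pn : P \is normalmx by apply/normalmxP; rewrite -/(adjmx P) Padj.
have /orthomx_spectralP := Pn; set U := spectralmx P; set d := spectral_diag P => PE.
have Uu : U \is unitarymx := spectral_unitarymx P.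
have UK : U *m adjmx U = 1%:M by apply/unitarymxP.
have UV : invmx U = adjmx U by exact: invmx_unitary.
have dE : diag_mx d = U *m P *m adjmx U.
  by rewrite PE UV !mulmxA UK mul1mx -mulmxA UK mulmx1.
(* The eigenvalue is the quadratic form evaluated at the eigenvector, the conjugate of the row [i]
   of [U]. *)
have d0 i : 0 <= d 0 i.
  have -> : d 0 i = \sum_k \sum_j ((U i k)^*)^* * P k j * (U i j)^*.
    have := congr1 (fun M : 'M[C]_n => M i i) dE; rewrite [LHS]mxE eqxx mulr1n => ->.
    rewrite mxE exchange_big /=; apply: eq_bigr => j _; rewrite adjmxE mxE mulr_suml.
    by apply: eq_bigr => k _; rewrite conjCK.
  exact: Ppsd (fun k => (U i k)^*).
exists (diag_mx (map_mx sqrtC d) *m U).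
have sE l j : (diag_mx (map_mx sqrtC d) *m U) l j = sqrtC (d 0 l) * U l j.
  by rewrite mul_diag_mx !mxE.
apply/matrixP => i j; rewrite {1}PE UV mxE [RHS]mxE; apply: eq_bigr => l _.
rewrite mul_mx_diag mxE !adjmxE !sE rmorphM /= [(sqrtC _)^*]geC0_conj ?sqrtC_ge0//.
by rewrite [RHS]mulrACA -expr2 sqrtCK [RHS]mulrCA [RHS]mulrA.
Qed.

Lemma l2norm_sqr n (v : 'cV[C]_n) : l2norm v ^+ 2 = \sum_i `|v i 0| ^+ 2.
Proof. exact: sqrtCK. Qed.

Lemma l2norm_ge0 n (v : 'cV[C]_n) : 0 <= l2norm v.
Proof. by rewrite sqrtC_ge0 sumr_ge0// => i _; rewrite exprn_ge0. Qed.

Lemma opnorm_le_factor n (M : 'M[C]_n) c : opnorm_le M c ->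
  exists Z : 'M[C]_n, adjmx Z *m Z + adjmx M *m M = (c ^+ 2)%:M.
Proof.
move=> [c0 Mc].
(* [c^2 - M^* M] is positive semidefinite. *)
have [||Z hZ] := @psd_factor n ((c ^+ 2)%:M - adjmx M *m M); last first.
- by exists Z; rewrite -hZ subrK.
- move=> v; pose w : 'cV[C]_n := \col_i v i.
  have h : l2norm (M *m w) ^+ 2 <= (c * l2norm w) ^+ 2.
    by rewrite ler_pXn2r ?nnegrE ?mulr_ge0 ?l2norm_ge0.
  rewrite exprMn !l2norm_sqr -subr_ge0 in h.
  suff <- : c ^+ 2 * (\sum_i `|w i 0| ^+ 2) - \sum_i `|(M *m w) i 0| ^+ 2 =
    \sum_i \sum_j (v i)^* * ((c ^+ 2)%:M - adjmx M *m M) i j * v j by [].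
  have -> : \sum_i `|(M *m w) i 0| ^+ 2 =
      \sum_i \sum_j (v i)^* * (adjmx M *m M) i j * v j.
    transitivity (\sum_k \sum_i \sum_j ((M k i * v i)^* * (M k j * v j))).
      apply: eq_bigr => k _; rewrite normCKC mxE rmorph_sum mulr_suml.
      apply: eq_bigr => i _; rewrite mulr_sumr; apply: eq_bigr => j _.
      by rewrite !mxE.
    rewrite exchange_big /=; apply: eq_bigr => i _.
    rewrite exchange_big /=; apply: eq_bigr => j _.
    rewrite mxE mulr_sumr mulr_suml; apply: eq_bigr => k _.
    by rewrite adjmxE rmorphM /= [(M k i)^* * _]mulrC !mulrA.
  rewrite mulr_sumr -sumrB; apply: eq_bigr => i _.
  transitivity (\sum_j ((v i)^* * (c ^+ 2)%:M i j * v j) -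
                \sum_j (v i)^* * (adjmx M *m M) i j * v j).
    congr (_ - _); rewrite (bigD1 i) //= big1 ?addr0; last first.
      by move=> j ji; rewrite mxE eq_sym (negbTE ji) mulr0n mulr0 mul0r.
    by rewrite !mxE eqxx mulr1n normCK; ring.
  rewrite -sumrB; apply: eq_bigr => j _.
  have -> : ((c ^+ 2)%:M - adjmx M *m M) i j = (c ^+ 2)%:M i j - (adjmx M *m M) i j.
    by rewrite mxE [X in _ + X]mxE.
  by rewrite mulrBr mulrBl.
- move=> i j; rewrite !mxE rmorphB /= rmorphMn /= eq_sym; congr (_ - _).
    by rewrite geC0_conj// exprn_ge0.
  rewrite rmorph_sum; apply: eq_bigr => k _.
  by rewrite !adjmxE rmorphM /= conjCK mulrC.
Qed.

End PositiveMatrices.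

Section HilbertSums.
Variables (R : realType) (H : hilbertSpace R).
Implicit Types x y : H.

Lemma hdot0l x : hdot H 0 x = 0. Proof. exact: linear0l. Qed.
Lemma hdot0r x : hdot H x 0 = 0. Proof. exact: linear0r. Qed.

Lemma hdot_suml (J : Type) (s : seq J) (P : pred J) (F : J -> H) y :
  hdot H (\sum_(j <- s | P j) F j) y = \sum_(j <- s | P j) hdot H (F j) y.
Proof. by apply: (big_morph (fun x => hdot H x y)) => [? ?|]; rewrite ?hdotDl ?hdot0l. Qed.

Lemma hdot_sumr (J : Type) (s : seq J) (P : pred J) (F : J -> H) y :
  hdot H y (\sum_(j <- s | P j) F j) = \sum_(j <- s | P j) hdot H y (F j).
Proof. by apply: (big_morph (hdot H y)) => [? ?|]; rewrite ?hdotDr ?hdot0r. Qed.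

Variables (J : finType) (u : J -> H).
Hypothesis u_orth : forall i j, hdot H (u i) (u j) = (i == j)%:R.

Lemma orthonormal_sum_norm (c : J -> R[i]) :
  `|\sum_j c j *: u j| ^+ 2 = \sum_j `|c j| ^+ 2.
Proof.
rewrite -hdot_norm hdot_suml; apply: eq_bigr => j _.
rewrite hdot_sumr (bigD1 j) //= big1 ?addr0; last first.
  by move=> i ij; rewrite hdotZl hdotZr u_orth eq_sym (negbTE ij) !mulr0.
by rewrite hdotZl hdotZr u_orth eqxx mulr1 normCK.
Qed.

Lemma bessel y : \sum_j `|hdot H y (u j)| ^+ 2 <= `|y| ^+ 2.
Proof.
pose z := \sum_j hdot H y (u j) *: u j.
have zz : hdot H z z = \sum_j `|hdot H y (u j)| ^+ 2.
  by rewrite hdot_norm orthonormal_sum_norm.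
have yz : hdot H y z = \sum_j `|hdot H y (u j)| ^+ 2.
  by rewrite hdot_sumr; apply: eq_bigr => j _; rewrite hdotZr normCKC.
have zy : hdot H z y = \sum_j `|hdot H y (u j)| ^+ 2.
  rewrite hdotC yz geC0_conj// sumr_ge0// => j _; exact: exprn_ge0.
have : 0 <= `|y - z| ^+ 2 by rewrite exprn_ge0.
by rewrite -hdot_norm hdotBl !hdotBr zz yz zy subrr subr0 hdot_norm subr_ge0.
Qed.

End HilbertSums.

Section Approximation.
Variables (R : realType) (D L : zmodType) (b : pairing D L) (P : dual_pair b).
Local Notation C := R[i].
Local Notation I := (D + L)%type.
Local Notation H := (ell2_hilbert R I).
Local Notation B := (weyl_cstar R b).
Local Notation Q := (dpQ P).
Local Notation N := (#|Q|).
Local Notation ev := (@enum_val Q predT).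

(** Distinct indices give distinct basis vectors because perfect duality makes [dpl] injective. *)
Lemma dvec_orth (p q : Q) : hdot H (dvec R p) (dvec R q) = (p == q)%:R.
Proof.
rewrite [LHS](ell2_dot_delta (dvec R p)) deltaE; congr (nat_of_bool _)%:R.
apply/eqP/eqP => [[E]|->//]; apply/eqP; apply: contraT => pq.
have [r] : exists r : Q, b (dpl (p + q)) (dpr r).
  by apply: dp_ndl; rewrite addr_eq0 dpQ_opp.
by rewrite dplD E pairDl addbb.
Qed.

Lemma dvec_orth_ord (i j : 'I_N) : hdot H (dvec R (ev i)) (dvec R (ev j)) = (i == j)%:R.
Proof. by rewrite dvec_orth (inj_eq enum_val_inj). Qed.

Definition compress (x : B) : 'M[C]_N :=
  \matrix_(i, j) hdot H (act x (dvec R (ev j))) (dvec R (ev i)).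

Definition embed (M : 'M[C]_N) : B :=
  \sum_i \sum_j M i j *: munit R (ev i) (ev j).

Lemma compress_linear : linear compress.
Proof. by move=> c x y; apply/matrixP => i j; rewrite !mxE actD actZ hdotDl hdotZl. Qed.

Lemma embed_linear : linear embed.
Proof.
move=> c M M'; rewrite /embed scaler_sumr -big_split; apply: eq_bigr => i _.
rewrite scaler_sumr -big_split; apply: eq_bigr => j _.
by rewrite !mxE scalerDl scalerA.
Qed.

HB.instance Definition _ := GRing.isLinear.Build C B 'M[C]_N _ compress compress_linear.
HB.instance Definition _ := GRing.isLinear.Build C 'M[C]_N B _ embed embed_linear.

Lemma embedM M M' : embed (M *m M') = cmul (embed M) (embed M').
Proof.
rewrite /embed (@cmul_suml R B); apply: eq_bigr => i _.
rewrite (@cmul_suml R B).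
transitivity (\sum_k \sum_j (M i k * M' k j) *: munit R (ev i) (ev j)).
  rewrite exchange_big /=; apply: eq_bigr => j _.
  by rewrite mxE scaler_suml.
apply: eq_bigr => k _; rewrite (@cmul_sumr R B) [RHS](bigD1 k) //=.
rewrite [X in _ = _ + X]big1 ?addr0; last first.
  move=> l lk; rewrite (@cmul_sumr R B) big1// => j _.
  by rewrite cmulZl cmulZr munitM (inj_eq enum_val_inj) eq_sym (negbTE lk) mulr0n !scaler0.
rewrite (@cmul_sumr R B); apply: eq_bigr => j _.
by rewrite cmulZl cmulZr munitM eqxx mulr1n scalerA.
Qed.

Lemma embed_star M : embed (adjmx M) = cstar (embed M).
Proof.
rewrite /embed (@cstar_sum R B) exchange_big /=; apply: eq_bigr => i _.
rewrite (@cstar_sum R B); apply: eq_bigr => j _.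
by rewrite adjmxE cstarZ munit_star.
Qed.

Lemma sum_enum_val (V : nmodType) (F : Q -> V) : \sum_(i : 'I_N) F (ev i) = \sum_p F p.
Proof. by rewrite [RHS](reindex ev)//; exact/onW_bij/enum_val_bij. Qed.

Lemma embed_scalar c : embed c%:M = c *: weylc R b 0 0.
Proof.
rewrite /embed -(munit_sum1 R P) -sum_enum_val scaler_sumr; apply: eq_bigr => i _.
rewrite (bigD1 i) //= big1 ?addr0 ?mxE ?eqxx ?mulr1n// => j ji.
by rewrite mxE eq_sym (negbTE ji) mulr0n scale0r.
Qed.

Lemma compress_munit (p q : Q) i j : compress (munit R p q) i j = ((p == ev i) && (q == ev j))%:R.
Proof.
rewrite mxE act_munit_dvec; case: (q == ev j); last by rewrite mulr0n hdot0l andbF.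
by rewrite mulr1n dvec_orth andbT.
Qed.

Lemma embed_compress_munit (p q : Q) : embed (compress (munit R p q)) = munit R p q.
Proof.
rewrite /embed.
transitivity (\sum_(i : 'I_N) \sum_(j : 'I_N)
  (((p == ev i) && (q == ev j))%:R : C) *: munit R (ev i) (ev j)).
  by apply: eq_bigr => i _; apply: eq_bigr => j _; rewrite compress_munit.
rewrite (sum_enum_val (fun p' => \sum_j (((p == p') && (q == ev j))%:R : C) *: munit R p' (ev j))).
rewrite (bigD1 p) //= [X in _ + X]big1 ?addr0; last first.
  by move=> p' /negbTE pp; rewrite big1// => j _; rewrite eq_sym pp scale0r.
rewrite (sum_enum_val (fun q' => (((p == p) && (q == q'))%:R : C) *: munit R p q')).
rewrite (bigD1 q) //= [X in _ + X]big1 ?addr0; last first.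
  by move=> q' /negbTE qq; rewrite eqxx eq_sym qq scale0r.
by rewrite !eqxx scale1r.
Qed.

Lemma embed_compress_wQ (p r : Q) : embed (compress (wQ R p r)) = wQ R p r.
Proof.
rewrite wQ_munit (linear_pred_sum compress_linear) (linear_pred_sum embed_linear).
apply: eq_bigr => t _.
by rewrite (linear_predZ compress_linear) (linear_predZ embed_linear) embed_compress_munit.
Qed.

(* [c^2 - M^* M = Z^* Z] is carried by [embed] to an identity of operators, so
   the bound holds on [ell2 D] and on [ell2 L] at once. *)
Lemma embed_norm M c : opnorm_le M c -> `|embed M| <= c.
Proof.
move=> Mc; have [c0 _] := Mc; have [Z hZ] := opnorm_le_factor Mc.
apply: act_norm_le; split=> // v.
rewrite -(@ler_pXn2r _ 2) ?nnegrE ?mulr_ge0// exprMn -!hdot_norm.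
have sq M' : hdot H (act (embed M') v) (act (embed M') v) =
    hdot H (act (embed (adjmx M' *m M')) v) v.
  by rewrite embedM embed_star act_mul -(op_adjoint_sym (@act_adjoint _ _ _ _ _)).
have : c ^+ 2 * hdot H v v = hdot H (act (embed Z) v) (act (embed Z) v) +
   hdot H (act (embed M) v) (act (embed M) v).
  rewrite !sq -hdotDl -actD -(linear_predD embed_linear) hZ embed_scalar.
  by rewrite actZ act_weylc0 hdotZl.
by move=> ->; rewrite lerDr hdot_norm exprn_ge0.
Qed.

Lemma compress_norm x : opnorm_le (compress x) `|x|.
Proof.
split=> // v; rewrite -(@ler_pXn2r _ 2) ?nnegrE ?mulr_ge0 ?l2norm_ge0// exprMn !l2norm_sqr.
(* The image of [v] under the isometry onto the span of the [dvec]; the entries of [compress x *m v]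
   are the Fourier coefficients of [act x y], to which Bessel's inequality applies. *)
pose y := \sum_j v j 0 *: dvec R (ev j).
have cE i : (compress x *m v) i 0 = hdot H (act x y) (dvec R (ev i)).
  rewrite mxE /y (linear_pred_sum (@act_linear _ _ _ _ x)) hdot_suml.
  apply: eq_bigr => j _; rewrite mxE (linear_predZ (@act_linear _ _ _ _ x)) hdotZl.
  by rewrite mulrC.
under eq_bigr do rewrite cE.
apply: (le_trans (bessel dvec_orth_ord _)).
rewrite -(orthonormal_sum_norm dvec_orth_ord) -exprMn ler_pXn2r ?nnegrE ?mulr_ge0//.
exact: act_le.
Qed.

Lemma embed_cp :
  completely_positive (@mulmx C N N N) (@adjmx R N) (@cmul R B) (@cstar R B) embed.
Proof.
move=> k X [Y XY]; exists (map_mx embed Y) => i j.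
rewrite mxE XY (linear_pred_sum embed_linear); apply: eq_bigr => l _.
by rewrite embedM embed_star !mxE.
Qed.

(** [compress] is not multiplicative, so it cannot be applied to the factor [Y]. Instead, all the
    entries of the compressed matrix form one scalar Gram matrix indexed by [T]; this is positive
    semidefinite, and cutting its factor [Z] into blocks gives the matrix over matrices. *)
Lemma compress_cp :
  completely_positive (@cmul R B) (@cstar R B) (@mulmx C N N N) (@adjmx R N) compress.
Proof.
move=> k X [Y XY]; pose T : finType := ('I_k * 'I_N)%type.
pose et := @enum_val T predT.
pose yv l (a : T) := act (Y l a.1) (dvec R (ev a.2)).
pose G (a c : T) := \sum_l hdot H (yv l c) (yv l a).
have XG i j p q : compress (X i j) p q = G (i, p) (j, q).
  rewrite mxE XY act_sum hdot_suml; apply: eq_bigr => l _.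
  by rewrite act_mul -(op_adjoint_sym (@act_adjoint _ _ _ _ _)).
have [||Z hZ] := @psd_factor R #|T| (\matrix_(i, j) G (et i) (et j)).
- move=> i j; rewrite !mxE rmorph_sum; apply: eq_bigr => l _; exact: hdotC.
- move=> v; pose y l := \sum_j v j *: yv l (et j).
  suff -> : \sum_i \sum_j (v i)^* * (\matrix_(i, j) G (et i) (et j)) i j * v j =
      \sum_l hdot H (y l) (y l).
    by apply: sumr_ge0 => l _; rewrite hdot_norm exprn_ge0.
  transitivity (\sum_l \sum_i \sum_j (v i)^* * v j * hdot H (yv l (et j)) (yv l (et i))).
    rewrite [RHS]exchange_big /=; apply: eq_bigr => i _.
    rewrite [RHS]exchange_big /=; apply: eq_bigr => j _.
    by rewrite mxE mulrAC mulr_sumr.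
  apply: eq_bigr => l _; rewrite /y hdot_sumr; apply: eq_bigr => i _.
  rewrite hdot_suml; apply: eq_bigr => j _.
  by rewrite hdotZl hdotZr mulrA [v j * _]mulrC.
pose er := @enum_rank T.
exists (\matrix_(l, i) \matrix_(r, p) Z (er (l, r)) (er (i, p))) => i j.
apply/matrixP => p q; rewrite mxE XG summxE.
have := congr1 (fun M : 'M[C]_(#|T|) => M (er (i, p)) (er (j, q))) hZ.
rewrite [LHS]mxE /et /er !enum_rankK => ->.
rewrite mxE (reindex (@enum_rank T)); last exact/onW_bij/enum_rank_bij.
transitivity (\sum_l \sum_r adjmx Z (er (i, p)) (er (l, r)) * Z (er (l, r)) (er (j, q))).
  by rewrite pair_bigA; apply: eq_bigr => -[l r] _.
apply: eq_bigr => l _; rewrite [RHS]mxE; apply: eq_bigr => r _.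
by rewrite !adjmxE !mxE.
Qed.

End Approximation.

(** * Nuclearity and simplicity *)

Section SimpleNuclear.
Variables (R : realType) (D L : zmodType) (b : pairing D L).
Local Notation C := R[i].
Local Notation I := (D + L)%type.
Local Notation H := (ell2_hilbert R I).
Local Notation B := (weyl_cstar R b).
Local Notation one := (weylc R b 0 0).

(** Only the finitely many indices occurring in [f] matter. Quantifying over every [P] that covers
    them lets the lists of several elements be concatenated in [weyl_approx]. *)
Lemma weyl_span_local f : @weyl_span R D L b f -> exists s : seq (D * L),
  forall P : dual_pair b, (forall t, t \in s -> dp_mem P t) ->
  forall x : B, act x =1 f -> embed (compress P x) = x.
Proof.
elim=> [|c d l g _ [s hs]].
  exists [::] => P _ x x0; have -> : x = 0 by apply: act_eq.
  by rewrite (linear_pred0 (@compress_linear _ _ _ _ P)) (linear_pred0 (@embed_linear _ _ _ _ P)).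
exists ((d, l) :: s) => P hP x xE.
have [p [q [dE lE]]] := hP (d, l) (mem_head _ _).
have <- : c *: weylc R b d l + (x - c *: weylc R b d l) = x by rewrite addrC subrK.
have -> : embed (compress P (c *: weylc R b d l + (x - c *: weylc R b d l))) =
    c *: embed (compress P (weylc R b d l)) + embed (compress P (x - c *: weylc R b d l)).
  by rewrite compress_linear embed_linear.
have -> : weylc R b d l = wQ R p q by rewrite /wQ dE lE.
rewrite embed_compress_wQ; congr (_ + _).
have -> : wQ R p q = weylc R b d l by rewrite /wQ dE lE.
apply: (hs P) => [t ts|v]; first by apply: hP; rewrite inE ts orbT.
have E : act x v = c *: weyl b d l v + g v := xE v.
by rewrite actD actN actZ act_weylc E addrAC subrr add0r.
Qed.

Lemma weyl_approx (F : seq B) (e : C) : 0 < e -> exists P : dual_pair b,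
  forall x, x \in F -> exists2 y : B, `|x - y| <= e & embed (compress P y) = y.
Proof.
move=> e0; suff [s hs] : exists s : seq (D * L), forall P : dual_pair b,
    (forall t, t \in s -> dp_mem P t) ->
    forall x, x \in F -> exists2 y : B, `|x - y| <= e & embed (compress P y) = y.
  by have [P hP] := dual_pair_cover b s; exists P; exact: hs.
elim: F => [|x F [s hs]]; first by exists [::].
have [y Sy xy] := weylc_dense x e0.
have [s' hs'] := weyl_span_local Sy.
exists (s' ++ s) => P hP z; rewrite inE => /orP[/eqP ->|zF].
  by exists y => //; apply: hs' => // t ts; apply: hP; rewrite mem_cat ts.
by apply: hs zF => t ts; apply: hP; rewrite mem_cat ts orbT.
Qed.

Lemma compress_embed_contractive (P : dual_pair b) (x : B) : `|embed (compress P x)| <= `|x|.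
Proof. exact/embed_norm/compress_norm. Qed.

Lemma weyl_nuclear : nuclear B.
Proof.
move=> F e e0; have e3 : 0 < e / 3 by rewrite divr_gt0.
have [P hP] := weyl_approx F e3.
exists #|dpQ P|, (compress P), (@embed _ _ _ _ P); split.
- exact: compress_cp.
- exact: compress_norm.
- exact: embed_cp.
- exact: embed_norm.
move=> x /hP[y xy yE] /=.
(* The approximant [y] is fixed by the composite, which is contractive; each term is at most
   [e / 3], leaving room for strictness. *)
have -> : embed (compress P x) - x = embed (compress P (x - y)) - (x - y).
  rewrite (linear_predB (@compress_linear _ _ _ _ P)).
  by rewrite (linear_predB (@embed_linear _ _ _ _ P)) yE opprB addrA subrK.
apply: (le_lt_trans (ler_normB _ _)).
apply: (@le_lt_trans _ _ (e / 3 + e / 3)).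
  by rewrite lerD//; apply: (le_trans (compress_embed_contractive _ _)).
by rewrite -subr_gt0; have -> : e - (e / 3 + e / 3) = e / 3 by field.
Qed.

Section Corner.
Variable P : dual_pair b.
Local Notation Q := (dpQ P).

Lemma embedE (M : 'M[C]_#|Q|) :
  embed M = \sum_p \sum_q M (enum_rank p) (enum_rank q) *: munit R p q.
Proof.
rewrite /embed -sum_enum_val; apply: eq_bigr => i _.
by rewrite -sum_enum_val; apply: eq_bigr => j _; rewrite !enum_valK.
Qed.

Lemma munit_corner (p q s t : Q) (M : 'M[C]_#|Q|) :
  cmul (munit R p q) (cmul (embed M) (munit R s t)) =
  M (enum_rank q) (enum_rank s) *: munit R p t.
Proof.
have sandwichZ c (x y z : B) : cmul x (cmul (c *: y) z) = c *: cmul x (cmul y z).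
  by rewrite cmulZl cmulZr.
have c0 (x : B) : cmul x 0 = 0 by exact: (linear_pred0 (@cmul_linearr R B x)).
rewrite embedE (@cmul_suml R B) (@cmul_sumr R B) (bigD1 q) //= [X in _ + X = _]big1 ?addr0.
  rewrite (@cmul_suml R B) (@cmul_sumr R B) (bigD1 s) //= [X in _ + X = _]big1 ?addr0.
    by rewrite sandwichZ !munitM !eqxx !mulr1n munitM eqxx mulr1n.
  by move=> u us; rewrite sandwichZ munitM (negbTE us) mulr0n c0 scaler0.
move=> u uq; rewrite (@cmul_suml R B) (@cmul_sumr R B) big1// => w _.
rewrite sandwichZ munitM; case: (w == s); last by rewrite mulr0n c0 scaler0.
by rewrite mulr1n munitM eq_sym (negbTE uq) mulr0n scaler0.
Qed.

Definition corner (x : B) : B :=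
  \sum_(p : Q) cmul (munit R p 0) (cmul x (munit R 0 p)).

Lemma munit_adj (p q : Q) (v w : H) :
  hdot H (act (munit R p q) v) w = hdot H v (act (munit R q p) w).
Proof. by rewrite act_adjoint munit_star. Qed.

(** The terms of [act (corner x) v] are pairwise orthogonal, and the squared norms of the vectors
    [act (munit R 0 p) v] add up to that of [v], because the diagonal units sum to 1. No factor for
    the number of terms is lost. *)
Lemma corner_norm x : `|corner x| <= `|x|.
Proof.
apply: act_norm_le; split=> // v.
rewrite -(@ler_pXn2r _ 2) ?nnegrE ?mulr_ge0// exprMn.
pose z (p : Q) := act x (act (munit R 0 p) v).
have cE : act (corner x) v = \sum_p act (munit R p 0) (z p).
  by rewrite act_sum; apply: eq_bigr.
(* A selfadjoint idempotent is contractive, by Cauchy-Schwarz. *)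
have z00 p : hdot H (act (munit R (0 : Q) 0) (z p)) (z p) <= `|z p| ^+ 2.
  set y := z p; set e := act _ y.
  have ee : hdot H e y = `|e| ^+ 2.
    by rewrite -hdot_norm {2}/e -munit_adj -act_mul munitM eqxx mulr1n.
  rewrite ee ler_pXn2r ?nnegrE//.
  have [->|e0] := eqVneq e 0; first by rewrite normr0.
  have ne : 0 < `|e| by rewrite normr_gt0.
  rewrite -(ler_pM2l ne) -expr2 -ee; apply: le_trans (hdot_le _ _).
  by rewrite ee [leRHS]ger0_norm// exprn_ge0.
have -> : `|act (corner x) v| ^+ 2 = \sum_p hdot H (act (munit R (0 : Q) 0) (z p)) (z p).
  rewrite -hdot_norm cE hdot_suml; apply: eq_bigr => p _.
  rewrite hdot_sumr (bigD1 p) //= big1 ?addr0 => [|q qp].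
    by rewrite -munit_adj -act_mul munitM eqxx mulr1n.
  by rewrite -munit_adj -act_mul munitM (negbTE qp) mulr0n act0 hdot0l.
apply: (@le_trans _ _ (\sum_p `|x| ^+ 2 * hdot H (act (munit R p p) v) v)).
  apply: ler_sum => p _; apply: (le_trans (z00 p)).
  have -> : hdot H (act (munit R p p) v) v = `|act (munit R 0 p) v| ^+ 2.
    by rewrite -hdot_norm -munit_adj -act_mul munitM eqxx mulr1n.
  by rewrite -exprMn ler_pXn2r ?nnegrE ?mulr_ge0//; exact: act_le.
rewrite -mulr_sumr -hdot_suml -act_sum munit_sum1 act_weylc0 hdot_norm.
exact: lexx.
Qed.

Lemma corner_embed (M : 'M[C]_#|Q|) :
  corner (embed M) = M (enum_rank 0) (enum_rank 0) *: one.
Proof.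
rewrite /corner; under eq_bigr do rewrite munit_corner.
by rewrite -scaler_sumr munit_sum1.
Qed.

Lemma cornerB x y : corner (x - y) = corner x - corner y.
Proof. by rewrite /corner -sumrB; apply: eq_bigr => p _; rewrite cmulBl cmulBr. Qed.

End Corner.

Lemma act_weylc_delta d l x :
  act (weylc R b d l) (delta R (inl x)) = sg R (b (x + d) l) *: delta R (inl (x + d)) :> H.
Proof.
apply: ell2_eq => -[y|y]; last by rewrite [LHS]weylEr ell2Z !deltaE !mulr0.
rewrite [LHS]weylEl ell2Z !deltaE.
have -> : (inl (y + d) == inl x :> I) = (inl y == inl (x + d) :> I).
  apply/eqP/eqP => -[]; last by move=> ->; rewrite (addDK b).
  by move=> <-; rewrite (addDK b).
by case: eqP => [[->]//|_]; rewrite !mulr0.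
Qed.

(* The norm of an element is already seen by its compressions to [ell2 D]. *)
Lemma weyl_coef_neq0 (x : B) : x != 0 ->
  exists p q : D, hdot H (act x (delta R (inl p))) (delta R (inl q)) != 0.
Proof.
move=> x0; apply: contrapT => h; move/eqP: x0; apply.
have {}h p q : hdot H (act x (delta R (inl p))) (delta R (inl q)) = 0.
  apply/eqP; apply: contrapT => /negP pq; apply: h; by exists p, q.
apply/eqP; rewrite -normr_le0; apply: ler_addgt0C => e e0; rewrite add0r.
have e2 : 0 < e / 2 by rewrite divr_gt0.
have [P /(_ x (mem_head _ _))[y xy yE]] := weyl_approx [:: x] e2.
have cx : compress P x = 0 by apply/matrixP => i j; rewrite !mxE h.
(* As the compression of [x] vanishes, [y] is recovered from the compression of [y - x]; so [y], and
   with it [x], is small on both summands. *)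
have : `|y| <= e / 2.
  apply: le_trans xy; rewrite distrC -[in leLHS]yE.
  have -> : compress P y = compress P (y - x).
    by rewrite (linear_predB (@compress_linear _ _ _ _ P)) cx subr0.
  exact: compress_embed_contractive.
move=> yle; rewrite -[x](subrK y) [leRHS]splitr.
by apply: (le_trans (ler_normD _ _)); rewrite lerD.
Qed.

Lemma norm_one_le : `|one| <= 1.
Proof. by apply: act_norm_le; split=> // v; rewrite act_weylc0 mul1r. Qed.

(* [1 - (1 - u)^n] lies in [J] and converges to [1]. *)
Lemma closed_ideal_one (J : set B) (u : B) : closed_ideal J -> J u ->
  `|one - u| <= 2^-1 -> J = setT.
Proof.
move=> [[cJ J0 Jlin] Jmul] Ju hu.
have JD x y : J x -> J y -> J (x + y).
  by move=> Jx Jy; rewrite -[x]scale1r; exact: Jlin.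
pose v := one - u; pose pw n := iter n (cmul v) one.
have pwJ n : J (one - pw n).
  elim: n => [|n IH]; first by rewrite subrr.
  have -> : one - pw n.+1 = (one - pw n) + cmul u (pw n).
    by rewrite /= /v cmulBl weylc0l opprB addrA addrAC.
  by apply: JD => //; case: (Jmul (pw n) u Ju).
have pwn n : `|pw n| <= hseq R n.
  suff h : `|pw n| <= 2^-1 ^+ n * 1.
    apply: (le_trans h); rewrite mulr1 exprVn lef_pV2 ?posrE ?ltr0n ?exprn_gt0//.
    by rewrite -natrX ler_nat ltn_expl.
  elim: n => [|n IH]; first by rewrite expr0 mulr1 norm_one_le.
  apply: (le_trans (cnormM _ _)); rewrite exprS -mulrA; apply: ler_pM => //.
have J1 : J one.
  apply: closed_approx => // e e0; have [n /(_ _ (leqnn _)) hn] := hseq_small e0.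
  exists (one - pw n) => //; rewrite opprB addrC subrK.
  by apply: (le_trans (pwn n)); exact: ltW.
apply/seteqP; split=> // x _; rewrite -(weylc0r x).
by case: (Jmul x one J1).
Qed.

Lemma weyl_simple : simple_cstar B.
Proof.
split.
  exists one; apply/eqP => h.
  have := congr1 (fun x : B => act x (delta R (inl 0))) h.
  rewrite act_weylc0 act0 => /(congr1 (fun f : H => `|f|)).
  by rewrite norm_delta normr0 => /eqP; rewrite oner_eq0.
move=> J Jideal; have [[cJ J0 Jlin] Jmul] := Jideal.
have [[x [Jx x0]]|none] := pselect (exists x, J x /\ x != 0); last first.
  left; apply/seteqP; split=> [x Jx|x ->//]; apply/eqP; apply: contrapT => /negP x0.
  by apply: none; exists x.
right; have JD y z : J y -> J z -> J (y + z).
  by move=> Jy Jz; rewrite -[y]scale1r; exact: Jlin.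
have JZ c y : J y -> J (c *: y).
  by move=> Jy; rewrite -[c *: y]addr0; exact: Jlin.
have [p [q pq]] := weyl_coef_neq0 x0.
(* Translating on both sides moves the nonzero coefficient to index 0, which belongs to every finite
   subgroup. *)
pose z := cmul (weylc R b q 0) (cmul x (weylc R b p 0)).
have Jz : J z by case: (Jmul (weylc R b q 0) _ (Jmul (weylc R b p 0) _ Jx).2).
pose t := hdot H (act z (delta R (inl 0))) (delta R (inl 0)).
have t0 : t != 0.
  rewrite /t /z !act_mul act_weylc_delta act_adjoint weylc_star actZ act_weylc_delta.
  by rewrite !pair0r !add0r /sg !expr0 !scale1r.
have nt : 0 < `|t| by rewrite normr_gt0.
(* The error enters twice, through the coefficient [m] and through [corner]; after division by [t]
   the total is the 1/2 required by [closed_ideal_one]. *)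
have e0 : 0 < `|t| / 4 by rewrite divr_gt0.
have [P /(_ z (mem_head _ _))[y zy yE]] := weyl_approx [:: z] e0.
pose m := compress P y (enum_rank 0) (enum_rank 0).
have mt : `|m - t| <= `|t| / 4.
  have dv : dvec R (0 : dpQ P) = delta R (inl 0) by rewrite /dvec (dp0l P).
  have -> : m - t = hdot H (act (y - z) (delta R (inl 0))) (delta R (inl 0)).
    by rewrite /m mxE enum_rankK dv actD actN hdotBl.
  apply: (le_trans (hdot_le _ _)); rewrite norm_delta mulr1.
  by apply: (le_trans (act_le _ _)); rewrite norm_delta mulr1 distrC.
have Jc : J (corner P z).
  rewrite /corner; apply: (big_ind J) => // r _.
  by case: (Jmul (munit R r 0) _ (Jmul (munit R 0 r) _ Jz).2).
have ct : `|t *: one - corner P z| <= `|t| / 2.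
  have -> : t *: one - corner P z = (t - m) *: one - corner P (z - y).
    by rewrite cornerB -[in corner P y]yE corner_embed -/m scalerBl opprB addrA subrK.
  apply: (le_trans (ler_normB _ _)).
  have -> : `|t| / 2 = `|t| / 4 + `|t| / 4 by field.
  apply: lerD; last by apply: (le_trans (corner_norm _ _)).
  rewrite normrZ distrC; apply: le_trans mt.
  by rewrite ler_piMr// norm_one_le.
apply: (@closed_ideal_one J (t^-1 *: corner P z)) => //; first exact: JZ.
have -> : one - t^-1 *: corner P z = t^-1 *: (t *: one - corner P z).
  by rewrite scalerBr scalerA mulVf// scale1r.
rewrite normrZ normfV mulrC ler_pdivrMr//.
by rewrite mulrC.
Qed.

End SimpleNuclear.

(** * Irreducible representations *)

Lemma bounded_linear_continuous (R : realType) (V W : normedModType R[i]) (f : V -> W) K :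
  linear f -> 0 <= K -> (forall x, `|f x| <= K * `|x|) -> continuous f.
Proof.
move=> flin K0 fK x; apply/cvgrPdist_lt => e e0.
have K1 : 0 < K + 1 by rewrite ltr_wpDl.
apply/nbhs_ballP; exists (e / (K + 1)); first by rewrite /= divr_gt0.
move=> y; rewrite -ball_normE /= => xy; rewrite -(linear_predB flin).
apply: (le_lt_trans (fK _)); apply: (@le_lt_trans _ _ ((K + 1) * `|x - y|)).
  by rewrite ler_wpM2r// lerDl.
by rewrite mulrC -ltr_pdivlMr.
Qed.

(** * Restriction of the action to one summand *)

Section Restriction.
Variables (R : realType) (D L : zmodType) (b : pairing D L).
Local Notation C := R[i].
Local Notation I := (D + L)%type.
Local Notation H := (ell2_hilbert R I).
Local Notation B := (weyl_cstar R b).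
Variables (J : choiceType) (inj : J -> I) (prj : I -> option J).
Hypothesis prjE : forall i j, (prj i == Some j) = (i == inj j).
Local Notation HJ := (ell2_hilbert R J).

Lemma prj_inj j : prj (inj j) = Some j.
Proof. by apply/eqP; rewrite prjE. Qed.

Lemma prj_partial_inverse : partial_inverse prj (fun j => Some (inj j)).
Proof. by move=> i j; rewrite prjE eq_sym. Qed.

Definition extend0 : HJ -> H := pull prj_partial_inverse (fun=> false).

Definition restrict : H -> HJ := pull (partial_inverse_sym prj_partial_inverse) (fun=> false).

Lemma restrictE v j : restrict v j = v (inj j).
Proof. by rewrite /restrict pullE /sg expr0 mul1r. Qed.

Lemma extend0E f j : extend0 f (inj j) = f j.
Proof. by rewrite /extend0 pullE prj_inj /sg expr0 mul1r. Qed.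

Lemma extend00 f i : prj i = None -> extend0 f i = 0.
Proof. by rewrite /extend0 pullE => ->. Qed.

Lemma extend0K (v : H) : (forall i, prj i = None -> v i = 0) -> extend0 (restrict v) = v.
Proof.
move=> hv; apply: ell2_eq => i; case E : (prj i) => [j|]; last by rewrite extend00// hv.
by move/eqP: E; rewrite prjE => /eqP ->; rewrite extend0E restrictE.
Qed.

Lemma extend0_dot (f : HJ) (v : H) : hdot H (extend0 f) v = hdot HJ f (restrict v).
Proof. exact: pull_adjoint. Qed.

Lemma restrict_dot (v : H) (f : HJ) : hdot HJ (restrict v) f = hdot H v (extend0 f).
Proof. by rewrite hdotC -extend0_dot -hdotC. Qed.

Hypothesis weyl_prj : forall d l (v : H), (forall i, prj i = None -> v i = 0) ->
  forall i, prj i = None -> weyl b d l v i = 0.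

(** Invariance of the summand passes from the Weyl operators to their span, and then to the closure
    because coordinates are norm continuous. *)
Lemma act_prj (x : B) (v : H) : (forall i, prj i = None -> v i = 0) ->
  forall i, prj i = None -> act x v i = 0.
Proof.
move=> hv i hi; apply/eqP; rewrite -normr_le0.
apply: (@le0_hseq _ _ `|v|) => // n.
have [y Sy xy] := weylc_dense x (hseq_gt0 R n).
have yi : act y v i = 0.
  elim: Sy => [//|c d l f _ IH].
  rewrite -[LHS]/(c * weyl b d l v i + f v i) IH addr0.
  by rewrite weyl_prj// mulr0.
have -> : act x v i = act (x - y) v i by rewrite actD actN ell2D ell2N yi subr0.
apply: (le_trans (ell2_coord_le _ _)); apply: (le_trans (act_le _ _)).
by rewrite mulrC ler_wpM2l.
Qed.

Definition restrict_rep (x : B) (f : HJ) : HJ := restrict (act x (extend0 f)).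

Lemma restrict_rep_weylc d l f j :
  restrict_rep (weylc R b d l) f j = weyl b d l (extend0 f) (inj j).
Proof. by rewrite restrictE act_weylc. Qed.

Lemma restrict_rep1 f : restrict_rep (weylc R b 0 0) f = f.
Proof. by apply: ell2_eq => j; rewrite restrictE act_weylc0 extend0E. Qed.

Lemma restrict_rep_linear x : linear (restrict_rep x).
Proof.
move=> c f g; rewrite /restrict_rep [extend0 _]pull_linear (@act_linear _ _ _ _ x).
exact: pull_linear.
Qed.

Lemma restrict_rep_le x f : `|restrict_rep x f| <= `|x| * `|f|.
Proof.
apply: (le_trans (pull_norm_le _ _ _)); apply: (le_trans (act_le _ _)).
by rewrite ler_wpM2l//; exact: pull_norm_le.
Qed.

Lemma restrict_representation : representation restrict_rep.
Proof.
split.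
- exact: restrict_rep_linear.
- move=> x; apply: (@bounded_linear_continuous _ _ _ _ `|x|) => //.
    exact: restrict_rep_linear.
  exact: restrict_rep_le.
- move=> c x y f; rewrite /restrict_rep actD actZ; exact: pull_linear.
(* Cutting down to the summand is multiplicative because the summand is invariant. *)
- move=> x y f; rewrite /restrict_rep act_mul extend0K//.
  apply: act_prj => i; exact: extend00.
- move=> x f g; by rewrite restrict_dot act_adjoint extend0_dot.
Qed.

Lemma restrict_irreducible : (exists j : J, True) ->
  (forall x y : J, x != y -> exists d l s, s x != s y /\
    forall f j, restrict_rep (weylc R b d l) f j = sg R (s j) * f j) ->
  (forall x y : J, exists d l, restrict_rep (weylc R b d l) (delta R x) = delta R y) ->
  irreducible_rep restrict_rep.
Proof.
move=> [j0 _] sep trans; split; first exact: restrict_representation.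
  exists (weylc R b 0 0), (delta R j0); rewrite restrict_rep1.
  by rewrite -normr_eq0 norm_delta oner_eq0.
move=> K clK invK; apply: ell2_invariant_subspace => // x y.
  move=> /sep[d [l [s [sxy sE]]]]; exists s => // f Kf.
  have -> : mulsg s f = restrict_rep (weylc R b d l) f.
    by apply: ell2_eq => j; rewrite sE mulsgE.
  exact: invK.
by have [d [l <-]] := trans x y; exact: invK.
Qed.

End Restriction.

Section BinaryPairing.
Local Notation D := {poly bool}.
Local Notation L := (nat -> bool).

(** Polynomials over the field with two elements serve as finite bit sequences, since they form a
    countable type and an additive group. The sum is taken in that field, so it is a parity. *)
Definition bpair (p : D) (l : L) : bool := \sum_(i < size p) p`_i * l i.

Lemma bpairE n (p : D) l : (size p <= n)%N -> bpair p l = \sum_(i < n) p`_i * l i.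
Proof.
move=> pn; rewrite /bpair (big_ord_widen n (fun i => p`_i * l i))// big_mkcond /=.
by apply: eq_bigr => i _; case: ltnP => // /leq_sizeP ->.
Qed.

Lemma bpairDl (p q : D) l : bpair (p + q) l = bpair p l (+) bpair q l.
Proof.
rewrite !(@bpairE (maxn (size p) (size q))) ?leq_maxl ?leq_maxr ?size_polyD//.
rewrite -[RHS]/(_ + _) -big_split; apply: eq_bigr => i _.
by rewrite coefD mulrDl.
Qed.

Lemma bpairDr (p : D) l m : bpair p (l + m) = bpair p l (+) bpair p m.
Proof.
by rewrite -[RHS]/(_ + _) -big_split; apply: eq_bigr => i _; rewrite fctE mulrDr.
Qed.

Lemma poly_boolDD (p : D) : p + p = 0.
Proof. by apply/polyP => i; rewrite coefD coef0; exact: addbb. Qed.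

Lemma fun_boolDD (l : L) : l + l = 0.
Proof. by apply/funext => i; exact: addbb. Qed.

Lemma bpair_ndl (p : D) : p != 0 -> exists l, bpair p l.
Proof.
(* The indicator of the top degree reads off the leading coefficient. *)
move=> p0; exists (fun i => i == (size p).-1).
have sp : (0 < size p)%N by rewrite size_poly_gt0.
have sp' : ((size p).-1 < size p)%N by rewrite ltn_predL.
rewrite /bpair (bigD1 (Ordinal sp'))//= eqxx mulr1 big1 ?addr0.
  by have : lead_coef p != 0; [rewrite lead_coef_eq0 | rewrite /lead_coef; case: p`_ _].
move=> i ip; have /negbTE -> : (i : nat) != (size p).-1; last by rewrite mulr0.
by apply: contra ip => /eqP ip; apply/eqP/val_inj.
Qed.

Lemma bpair_ndr (l : L) : l != 0 -> exists p, bpair p l.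
Proof.
move=> l0; have [i li] : exists i, l i.
  apply: contrapT => /forallNP h; move/eqP: l0; apply; apply/funext => i.
  by apply/negbTE/negP; exact: h.
exists 'X^i; rewrite (@bpairE i.+1) ?size_polyXn// big_ord_recr /= coefXn eqxx mul1r.
rewrite big1 ?add0r// => j _; rewrite coefXn (ltn_eqF (ltn_ord j)).
exact: mul0r.
Qed.

Definition binary_pairing : pairing D L :=
  Pairing bpairDl bpairDr poly_boolDD fun_boolDD bpair_ndl bpair_ndr.

(** Cantor's diagonal argument for an injection into [nat]: [g] contains [n] exactly when no
    sequence coded by [n] does. *)
Lemma uncountable_binary_sequences : ~ countable [set: L].
Proof.
move=> /countable_injP[f f_inj].
pose g : L := fun n => `[< ~ exists h : L, f h = n /\ h n >].
have gE : g (f g) <-> ~ g (f g).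
  split=> [/asboolP h hg|h]; first by apply: h; exists g.
  apply/asboolP => -[k [fk kg]]; apply: h.
  have kE : k = g by apply: f_inj => //; exact: mem_set.
  by rewrite kE in kg.
have nh : ~ g (f g) by move=> h; exact: (gE.1 h h).
exact/nh/gE.
Qed.

End BinaryPairing.

Theorem theorem1 (R : realType) :
  exists B : cstarAlgebra R,
    [/\ simple_cstar B,
        nuclear B,
        exists (H : hilbertSpace R) (pi : B -> H -> H),
          irreducible_rep pi /\ separable H &
        exists (H : hilbertSpace R) (pi : B -> H -> H),
          irreducible_rep pi /\ ~ separable H].
Proof.
pose D : zmodType := {poly bool}; pose L : zmodType := nat -> bool.
pose b : pairing D L := binary_pairing.
exists (weyl_cstar R b); split.
- exact: weyl_simple.
- exact: weyl_nuclear.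
- pose prj (i : D + L) : option D := if i is inl x then Some x else None.
  have prjE (i : D + L) j : (prj i == Some j) = (i == inl j) by case: i.
  exists (ell2_hilbert R D), (restrict_rep prjE); split; last exact: ell2_separable.
  apply: restrict_irreducible.
  + move=> d l v hv [x|y] // _; rewrite weylEr (hv (inr (y + l)))//.
    exact: mulr0.
  + by exists 0.
  (* In exponent 2, [x + y] is the difference of [x] and [y]; an [l] pairing nontrivially with it
     separates them. *)
  + move=> x y xy; have [|l hl] := @pair_ndl _ _ b (x + y).
      by apply: contra xy => /eqP xy; rewrite -[x](addDK b _ y) xy add0r.
    exists 0, l, (fun z => b z l); split.
      by move: hl; rewrite pairDl; case: (b x l) (b y l) => [] [].
    by move=> f j; rewrite restrict_rep_weylc weylEl addr0 extend0E.
  (* Translation by [x + y] exchanges [x] and [y]. *)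
  + move=> x y; exists (x + y), 0; apply: ell2_eq => z.
    rewrite restrict_rep_weylc weylEl pair0r /sg expr0 mul1r extend0E !deltaE.
    congr (nat_of_bool _)%:R; apply/eqP/eqP => [h|->].
      by rewrite -[z](addDK b _ (x + y)) h addrA (addDD b) add0r.
    by rewrite addrCA (addDD b) addr0.
- pose prj (i : D + L) : option L := if i is inr x then Some x else None.
  have prjE (i : D + L) j : (prj i == Some j) = (i == inr j) by case: i.
  exists (ell2_hilbert R L), (restrict_rep prjE); split.
    apply: restrict_irreducible.
    + move=> d l v hv [x|y] // _; rewrite weylEl (hv (inl (x + d)))//.
      exact: mulr0.
    + by exists 0.
    + move=> x y xy; have [|d hd] := @pair_ndr _ _ b (x + y).
        by apply: contra xy => /eqP xy; rewrite -[x](addLK b _ y) xy add0r.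
      exists d, 0, (b d); split.
        by move: hd; rewrite pairDr; case: (b d x) (b d y) => [] [].
      by move=> f j; rewrite restrict_rep_weylc weylEr addr0 extend0E.
    + move=> x y; exists 0, (x + y); apply: ell2_eq => z.
      rewrite restrict_rep_weylc weylEr pair0l /sg expr0 mul1r extend0E !deltaE.
      congr (nat_of_bool _)%:R; apply/eqP/eqP => [h|->].
        by rewrite -[z](addLK b _ (x + y)) h addrA (addLL b) add0r.
      by rewrite addrCA (addLL b) addr0.
  exact/ell2_nonseparable/uncountable_binary_sequences.
Qed.
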